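(* Let $X$ be a self-dual Hilbert $C^*$-module over a von Neumann algebra $A\subseteq\mathbb B(H)$. A sequence $(x_n)_n$ in $X$ is a weak frame for $X$ if and only if there is a surjective bounded module map $T:\ell^2_{\mathrm{strong}}(A)\to X$ such that $Te^{(n)}=x_n$ for each $n\in\mathbb N$. If $(x_n)_n$ is a weak frame in $X$ and if $R:X\to Y$ is a surjective bounded module map, where $Y$ is a self-dual Hilbert $A$-module, then the sequence $(Rx_n)_n$ is a weak frame in $Y$.
   Context: Hilbert $C^*$-modules are left modules with inner product linear in the first variable. A module map is an $A$-linear map. $X$ is self-dual if every bounded module map $X\to A$ has the form $y\mapsto\langle y,x\rangle$ for some $x\in X$. ''(strong)'' refers to the strong operator topology on $A\subseteq\mathbb B(H)$. $\ell^2_{\mathrm{strong}}(A)=\{(a_n)_{n\in\mathbb N}: a_n\in A,\ \sup_N\|\sum_{n=1}^Na_na_n^*\|<\infty\}$, a (self-dual) Hilbert $A$-module with inner product $\langle (a_n),(b_n)\rangle=\text{(strong)}\sum_{n} a_nb_n^*$. $e$ is the unit of $A$ and $e^{(n)}$ is the sequence with $e$ at the $n$-th place and zeros elsewhere. A sequence $(x_n)_n$ in a self-dual Hilbert $A$-module $X$ is a weak frame if there are constants $C,D>0$ with $C\langle x,x\rangle\le(\text{strong})\sum_{n=1}^{\infty}\langle x,x_n\rangle \langle x,x_n\rangle^*\le D\langle x,x\rangle$ for all $x\in X$ (strong convergence of the series being part of the requirement). *)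

(* Defs.v *)
From HB Require Import structures.
From mathcomp Require Import all_boot all_order all_algebra sesquilinear complex ring.
From mathcomp Require Import all_classical all_reals all_analysis.

Set Implicit Arguments.
Unset Strict Implicit.
Unset Printing Implicit Defensive.
Import Order.TTheory GRing.Theory Num.Theory numFieldNormedType.Exports.
Local Open Scope classical_set_scope.
Local Open Scope complex_scope.
Local Open Scope ring_scope.

HB.mixin Record CompleteNormedModule_isHilbert (R : realType) (H : Type)
    of CompleteNormedModule R[i] H := {
  hdot : {dot H for (@Num.conj R[i])};
  hdot_norm : forall h : H, hdot h h = `|h| ^+ 2
}.

#[short(type="hilbertType")]
HB.structure Definition Hilbert (R : realType) :=
  {H of CompleteNormedModule R[i] H & CompleteNormedModule_isHilbert R H}.

Section HilbertTheory.
Context (R : realType) (H : hilbertType R).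
Implicit Types (h k : H) (c : R[i]).

Lemma hdotC h k : hdot h k = (hdot k h)^*%R.
Proof. by have := @hermitian_subproof _ _ _ _ (@hdot R H) h k; rewrite expr0 mul1r. Qed.
Lemma hdotDl h h' k : hdot (h + h') k = hdot h k + hdot h' k.
Proof. exact: linearDl. Qed.
Lemma hdotBl h h' k : hdot (h - h') k = hdot h k - hdot h' k.
Proof. exact: linearBl. Qed.
Lemma hdotDr h k k' : hdot h (k + k') = hdot h k + hdot h k'.
Proof. exact: linearD. Qed.
Lemma hdotBr h k k' : hdot h (k - k') = hdot h k - hdot h k'.
Proof. exact: linearB. Qed.
Lemma hdotZl c h k : hdot (c *: h) k = c * hdot h k.
Proof. exact: linearZl_LR. Qed.
Lemma hdotZr c h k : hdot h (c *: k) = c^*%R * hdot h k.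
Proof. exact: linearZr_LR. Qed.
Lemma hdot0l h : hdot 0 h = 0.
Proof. by rewrite -[X in hdot X](scale0r 0) hdotZl mul0r. Qed.
Lemma hdot0r h : hdot h 0 = 0.
Proof. by rewrite hdotC hdot0l conjC0. Qed.
Lemma hdot_ge0 h : 0 <= hdot h h.
Proof. by rewrite hdot_norm exprn_ge0. Qed.

End HilbertTheory.

Section BoundedOperators.
Context (R : realType) (H : hilbertType R).

Definition bounded_by (M : R) (f : H -> H) := forall h, `|f h| <= M%:C * `|h|.

Definition bounded_linear : {pred H -> H} :=
  mem [set f | linear f /\ exists M, bounded_by M f].

Record bop := Bop { bop_fun :> H -> H; _ : bop_fun \in bounded_linear }.

HB.instance Definition _ := [isSub for bop_fun].
HB.instance Definition _ := gen_eqMixin bop.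
HB.instance Definition _ := gen_choiceMixin bop.

Lemma bopP (S : bop) : linear S /\ exists M, bounded_by M S.
Proof. by case: S => f /= /set_mem. Qed.

Lemma bop_ext (S T : bop) : S =1 T -> S = T.
Proof. by move=> ST; exact/val_inj/funext. Qed.

Lemma bounded_by_ge0 (M : R) f : bounded_by M f ->
  exists2 M' : R, 0 <= M' & bounded_by M' f.
Proof.
move=> fM; exists (Num.max M 0); first by rewrite le_max lexx orbT.
move=> h; apply: (le_trans (fM h)); apply: ler_wpM2r => //.
by rewrite lecR le_max lexx.
Qed.

Lemma bounded_linear_submod_closed : submod_closed bounded_linear.
Proof.
split.
  rewrite inE; split; first by move=> a x y /=; rewrite /= scaler0 addr0.
  by exists 0 => h; rewrite /= normr0 mul0r.
move=> a f g; rewrite !inE => -[lf [M fM]] [lg [N gN]]; split.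
  move=> b x y; rewrite /= !fctE lf lg !scalerDr !scalerA mulrC.
  by rewrite addrACA.
exists (complex.Re `|a| * M + N) => h; rewrite !fctE.
apply: (le_trans (ler_normD _ _)).
rewrite rmorphD rmorphM/= mulrDl; apply: lerD => //.
by rewrite normrZ -mulrA (_ : (complex.Re `|a|)%:C = `|a|) ?ler_wpM2l ?RRe_real ?normr_real //.
Qed.

HB.instance Definition _ := GRing.isSubmodClosed.Build _ _ bounded_linear
  bounded_linear_submod_closed.
HB.instance Definition _ := [SubChoice_isSubLmodule of bop by <:].

Lemma bop_id_subproof : (idfun : H -> H) \in bounded_linear.
Proof.
rewrite inE; split; first by move=> a x y.
by exists 1 => h; rewrite /= mul1r.
Qed.

Lemma bop_comp_subproof (S T : bop) : (S \o T) \in bounded_linear.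
Proof.
have [lS [M /bounded_by_ge0[M' M'0 SM]]] := bopP S.
have [lT [N TN]] := bopP T.
rewrite inE; split; first by move=> a x y; rewrite /= lT lS.
exists (M' * N) => h /=; apply: (le_trans (SM _)).
by rewrite rmorphM/= -mulrA ler_wpM2l // ler0c.
Qed.

Definition bop_id : bop := Bop bop_id_subproof.
Definition bop_comp (S T : bop) : bop := Bop (bop_comp_subproof S T).

Lemma bop0E h : (0 : bop) h = 0. Proof. by []. Qed.
Lemma bopDE (S T : bop) h : (S + T) h = S h + T h. Proof. by []. Qed.
Lemma bopNE (S : bop) h : (- S) h = - S h. Proof. by []. Qed.
Lemma bopZE a (S : bop) h : (a *: S) h = a *: S h. Proof. by []. Qed.

Lemma bop_linear (S : bop) : linear S. Proof. by have [] := bopP S. Qed.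

HB.instance Definition _ (S : bop) :=
  GRing.isLinear.Build R[i] H H _ (S : H -> H) (bop_linear S).

Lemma bop_compA : associative bop_comp.
Proof. by move=> S T U; exact: bop_ext. Qed.
Lemma bop_comp1l : left_id bop_id bop_comp.
Proof. by move=> S; exact: bop_ext. Qed.
Lemma bop_comp1r : right_id bop_id bop_comp.
Proof. by move=> S; exact: bop_ext. Qed.
Lemma bop_compDl : left_distributive bop_comp +%R.
Proof. by move=> S T U; exact: bop_ext. Qed.
Lemma bop_compDr : right_distributive bop_comp +%R.
Proof. by move=> S T U; apply: bop_ext => h; exact: (linearD S). Qed.

HB.instance Definition _ := GRing.Zmodule_isPzRing.Build bop
  bop_compA bop_comp1l bop_comp1r bop_compDl bop_compDr.

Definition opnorm (S : bop) : R := inf [set M | 0 <= M /\ bounded_by M S].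

Definition is_adjoint (S T : bop) := forall h k, hdot (S h) k = hdot h (T k).

(* The topology of {ptws H -> H} restricted to bounded operators is the strong
   operator topology. *)
Definition strongly_closed (A : set bop) :=
  forall S : bop,
    closure (bop_fun @` A : set {ptws H -> H}) (S : H -> H) -> A S.

End BoundedOperators.
Arguments bop {R} H.

(* A von Neumann algebra is a strongly closed *-subalgebra of B(H). Its unit is
   not required to be the identity of H, so that both usual conventions are
   covered. *)
Record vnalg (R : realType) (H : hilbertType R) := VNAlg {
  vn_set : set (bop H);
  vn_linear : forall (c : R[i]) S T, vn_set S -> vn_set T -> vn_set (c *: S + T);
  vn_mul : forall S T, vn_set S -> vn_set T -> vn_set (S * T);
  vn_adjoint : forall S, vn_set S -> exists2 T, vn_set T & is_adjoint S T;
  vn_closed : strongly_closed vn_set;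
  vn_unit : bop H;
  vn_unit_in : vn_set vn_unit;
  vn_mul1 : forall S, vn_set S -> vn_unit * S = S;
  vn_mulr1 : forall S, vn_set S -> S * vn_unit = S
}.

Section VNAlgebra.
Context (R : realType) (H : hilbertType R) (A : vnalg H).

Definition vn_pred : {pred bop H} := mem (vn_set A).

Record vn_type := VNElt { vn_val :> bop H; _ : vn_val \in vn_pred }.

HB.instance Definition _ := [isSub for vn_val].
HB.instance Definition _ := gen_eqMixin vn_type.
HB.instance Definition _ := gen_choiceMixin vn_type.

Lemma vn_valP (a : vn_type) : vn_set A a.
Proof. by case: a => a /= /set_mem. Qed.

Lemma vn_submod_closed : submod_closed vn_pred.
Proof.
have vn0 : vn_set A 0.
  by have := vn_linear (-1) (vn_unit_in A) (vn_unit_in A); rewrite scaleN1r addNr.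
split; first by rewrite inE.
by move=> c S T; rewrite !inE; exact: vn_linear.
Qed.

HB.instance Definition _ := GRing.isSubmodClosed.Build _ _ vn_pred
  vn_submod_closed.
HB.instance Definition _ := [SubChoice_isSubLmodule of vn_type by <:].

Lemma vn_mul_subproof (a b : vn_type) : (a : bop H) * (b : bop H) \in vn_pred.
Proof. by rewrite inE; apply: vn_mul; exact: vn_valP. Qed.

Lemma vn_one_subproof : vn_unit A \in vn_pred.
Proof. by rewrite inE; exact: vn_unit_in. Qed.

Definition vn_times (a b : vn_type) : vn_type := VNElt (vn_mul_subproof a b).
Definition vn_one : vn_type := VNElt vn_one_subproof.

Lemma vn_timesA : associative vn_times.
Proof. by move=> a b c; apply: val_inj; exact: mulrA. Qed.
Lemma vn_times1l : left_id vn_one vn_times.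
Proof. by move=> a; apply: val_inj; apply: vn_mul1; exact: vn_valP. Qed.
Lemma vn_times1r : right_id vn_one vn_times.
Proof. by move=> a; apply: val_inj; apply: vn_mulr1; exact: vn_valP. Qed.
Lemma vn_timesDl : left_distributive vn_times +%R.
Proof. by move=> a b c; apply: val_inj; exact: mulrDl. Qed.
Lemma vn_timesDr : right_distributive vn_times +%R.
Proof. by move=> a b c; apply: val_inj; exact: mulrDr. Qed.

HB.instance Definition _ := GRing.Zmodule_isPzRing.Build vn_type
  vn_timesA vn_times1l vn_times1r vn_timesDl vn_timesDr.

Lemma vn_star_subproof (a : vn_type) : exists b : vn_type, is_adjoint a b.
Proof.
have [T AT aT] := vn_adjoint (vn_valP a).
by exists (VNElt (mem_set AT : T \in vn_pred)).
Qed.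

Definition star (a : vn_type) : vn_type := projT1 (cid (vn_star_subproof a)).

Lemma starP (a : vn_type) : is_adjoint a (star a).
Proof. by rewrite /star; case: cid. Qed.

Definition op_le (a b : vn_type) :=
  forall h : H, 0 <= hdot ((b - a : vn_type) h) h.

Definition strong_cvg (u : nat -> vn_type) (l : vn_type) :=
  forall h : H, u n h @[n --> \oo] --> l h.

(* The limit is sought in A, which is strongly closed; the value is 0 if the
   series does not converge strongly. *)
Definition strong_sum (u : nat -> vn_type) : vn_type :=
  xget 0 [set l | strong_cvg (series u) l].

End VNAlgebra.

Coercion vn_type : vnalg >-> Sortclass.

Definition bounded_map (R : realType) (X Y : Type) (nX : X -> R) (nY : Y -> R)
  (f : X -> Y) := exists M : R, forall x, nY (f x) <= M * nX x.

Definition inner_norm (R : realType) (H : hilbertType R) (A : vnalg H) (X : Type)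
  (ip : X -> X -> A) (x : X) : R := Num.sqrt (opnorm (ip x x)).

(* The complex vector space structure of the module is c x := (c *: 1) *: x; it
   is the only one compatible with the action of A. *)
HB.mixin Record Lmodule_isHilbertMod (R : realType) (H : hilbertType R)
    (A : vnalg H) (X : Type) of GRing.Lmodule (vn_type A) X := {
  mdot : X -> X -> vn_type A;
  mdot_linear : forall (a : vn_type A) (x y z : X),
    mdot (a *: x + y) z = a * mdot x z + mdot y z;
  mdot_star : forall x y : X, star (mdot x y) = mdot y x;
  mdot_ge0 : forall x : X, op_le 0 (mdot x x);
  mdot_eq0 : forall x : X, mdot x x = 0 -> x = 0;
  mdot_complete : forall u : nat -> X,
    (forall eps : R, 0 < eps -> exists N : nat, forall m n : nat,
      (N <= m)%N -> (N <= n)%N -> inner_norm mdot (u m - u n) < eps) ->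
    exists l : X, inner_norm mdot (u n - l) @[n --> \oo] --> (0 : R)
}.

#[short(type="hilbertModType")]
HB.structure Definition HilbertMod (R : realType) (H : hilbertType R)
    (A : vnalg H) :=
  {X of GRing.Lmodule (vn_type A) X & Lmodule_isHilbertMod R H A X}.

Definition mnorm (R : realType) (H : hilbertType R) (A : vnalg H)
  (X : hilbertModType A) : X -> R := inner_norm (@mdot R H A X).

Definition self_dual (R : realType) (H : hilbertType R) (A : vnalg H)
  (X : hilbertModType A) :=
  forall f : {linear X -> A^o},
    bounded_map (@mnorm _ _ _ X) (fun a : A => opnorm a) f ->
    exists x : X, forall y : X, f y = mdot y x.

Definition weak_frame (R : realType) (H : hilbertType R) (A : vnalg H)
  (X : hilbertModType A) (x : nat -> X) :=
  exists C D : R, [/\ 0 < C, 0 < D & forall y : X,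
    exists S : A,
      [/\ strong_cvg (series (fun n => mdot y (x n) * star (mdot y (x n)))) S,
          op_le (C%:C *: mdot y y) S & op_le S (D%:C *: mdot y y)]].

Section OpnormTheory.
Context (R : realType) (H : hilbertType R).

Lemma opnormP (S : bop H) : 0 <= opnorm S /\ bounded_by (opnorm S) S.
Proof.
have [_ [M /bounded_by_ge0[M' M'0 SM']]] := bopP S.
have ne : [set M | 0 <= M /\ bounded_by M S] !=set0 by exists M'.
split; first by apply: lb_le_inf => // x [].
move=> h; set s := complex.Re `|S h|; set t := complex.Re `|h|.
have hs : `|S h| = s%:C by rewrite RRe_real ?normr_real.
have ht : `|h| = t%:C by rewrite RRe_real ?normr_real.
have key M0 : bounded_by M0 S -> s <= M0 * t.
  by move=> /(_ h); rewrite hs ht -rmorphM /= lecR.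
rewrite hs ht -rmorphM /= lecR.
have : 0 <= t by rewrite -lecR -ht normr_ge0.
rewrite le_eqVlt => /predU1P[t0|t0].
  by have := key _ SM'; rewrite -t0 !mulr0.
rewrite -ler_pdivrMr //; apply: lb_le_inf => // x [_ /key].
by rewrite ler_pdivrMr.
Qed.

Lemma opnorm_le (S : bop H) M : 0 <= M -> bounded_by M S -> opnorm S <= M.
Proof.
move=> M0 SM; apply: ge_inf; last by split.
by exists 0 => x [].
Qed.

End OpnormTheory.

Section StarTheory.
Context (R : realType) (H : hilbertType R) (A : vnalg H).
Implicit Types a b : A.

Lemma adjoint_ext (S T : H -> H) :
  (forall h k, hdot h (S k) = hdot h (T k)) -> S =1 T.
Proof.
move=> ST k; apply/eqP; rewrite -subr_eq0 -normr_eq0 -sqrf_eq0 -hdot_norm.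
by rewrite hdotBr ST subrr.
Qed.

Lemma starD a b : star (a + b) =1 (fun h => star a h + star b h).
Proof. by apply: adjoint_ext => h k; rewrite hdotDr -!starP -hdotDl. Qed.

Lemma starM a b : star (a * b) =1 (fun h => star b (star a h)).
Proof. by apply: adjoint_ext => h k; rewrite -!starP. Qed.

Lemma star0 : star (0 : A) =1 (fun=> 0).
Proof.
apply: adjoint_ext => h k; rewrite -starP.
exact: etrans (hdot0l k) (esym (hdot0r h)).
Qed.

Lemma starK a h : star (star a) h = a h.
Proof.
apply: (@adjoint_ext (star (star a)) a) => {}h k.
by rewrite -starP hdotC -starP -hdotC.
Qed.

End StarTheory.

Section StrongEll2.
Context (R : realType) (H : hilbertType R) (A : vnalg H).

Definition ell2_partial (a : nat -> A) : nat -> A :=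
  series (fun n => a n * star (a n)).

Definition ell2_pred : {pred nat -> A^o} :=
  mem [set a | exists M : R, forall N, opnorm (ell2_partial a N) <= M].

Lemma vn_sumE (u : nat -> A) N h : series u N h = \sum_(0 <= n < N) u n h.
Proof.
rewrite /series /=; elim: N => [|N IH]; first by rewrite !big_geq.
by rewrite !big_nat_recr //= -IH.
Qed.

Lemma ell2_partialC (a : nat -> A) N h k :
  hdot (ell2_partial a N h) k = hdot h (ell2_partial a N k).
Proof.
rewrite /ell2_partial !vn_sumE.
elim: N => [|N IH].
  by rewrite !big_geq // hdot0l hdot0r.
rewrite !big_nat_recr //= hdotDl hdotDr IH; congr (_ + _).
apply: (etrans (starP (a N) (star (a N) h) k)).
by rewrite starP starK.
Qed.

Lemma ell2_partial_dot (a : nat -> A) N h :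
  hdot (ell2_partial a N h) h = \sum_(0 <= n < N) `|star (a n) h| ^+ 2.
Proof.
rewrite /ell2_partial vn_sumE; elim: N => [|N IH].
  by rewrite !big_geq // hdot0l.
rewrite !big_nat_recr //= hdotDl IH; congr (_ + _).
by apply: (etrans (starP (a N) _ h)); rewrite hdot_norm.
Qed.

Lemma ell2_predP (a : nat -> A) : a \in ell2_pred <->
  exists2 K : R, 0 < K &
    forall N h, \sum_(0 <= n < N) `|star (a n) h| ^+ 2 <= K%:C * `|h| ^+ 2.
Proof.
rewrite inE /=; split=> [[M aM]|[K K0 aK]].
  have aM' N h : `|ell2_partial a N h| <= (Num.max M 0)%:C * `|h|.
    have [_ /(_ h) le] := opnormP (ell2_partial a N).
    by rewrite (le_trans le) // ler_wpM2r // lecR le_max aM.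
  set M' : R := Num.max M 0 in aM'.
  have M'0 : 0 <= M' by rewrite le_max lexx orbT.
  exists (1 + M' ^+ 2); first by rewrite ltr_pwDl ?sqr_ge0.
  move=> N h; rewrite -ell2_partial_dot.
  set S := ell2_partial a N in aM' *.
  have S0 : 0 <= hdot (S h) h.
    by rewrite ell2_partial_dot sumr_ge0 // => i _; rewrite exprn_ge0.
  have := hdot_ge0 (h - S h).
  rewrite hdotBl !hdotBr -ell2_partialC -/S !hdot_norm => ge0.
  have : hdot (S h) h <= `|h| ^+ 2 + `|S h| ^+ 2.
    rewrite -subr_ge0; apply: le_trans (addr_ge0 ge0 S0) _.
    by rewrite le_eqVlt; apply/orP; left; apply/eqP; ring.
  move/le_trans; apply; rewrite rmorphD rmorph1 mulrDl mul1r lerD2l.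
  rewrite rmorphXn /= -exprMn lerXn2r ?nnegrE ?mulr_ge0 ?ler0c //; exact: aM'.
exists K => N; apply: opnorm_le; first exact: ltW.
set S := ell2_partial a N => h.
have c0 : 0 < K%:C by rewrite ltcR.
have cR : (K%:C)^*%R = K%:C by rewrite conj_Creal // gtr0_real.
have := ell2_partial_dot a N (K%:C *: h - S h); rewrite -/S => E.
have : 0 <= hdot (S (K%:C *: h - S h)) (K%:C *: h - S h).
  by rewrite E sumr_ge0 // => i _; rewrite exprn_ge0.
have SS : hdot (S (S h)) h = `|S h| ^+ 2 by rewrite ell2_partialC hdot_norm.
have leh : hdot (S h) h <= K%:C * `|h| ^+ 2 by rewrite ell2_partial_dot.
have leS : hdot (S (S h)) (S h) <= K%:C * `|S h| ^+ 2 by rewrite ell2_partial_dot.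
rewrite (linearB (vn_val S)) (linearZ_LR (vn_val S)) /= hdotBl !hdotBr !hdotZl !hdotZr cR SS hdot_norm => ge0.
have {}ge0 : 0 <= K%:C * (K%:C ^+ 2 * `|h| ^+ 2 - `|S h| ^+ 2).
  have le3 := lerD (ler_wpM2l (ltW (mulr_gt0 c0 c0)) leh) leS.
  rewrite -subr_ge0 in le3; apply: le_trans (addr_ge0 ge0 le3) _.
  by rewrite le_eqVlt; apply/orP; left; apply/eqP; ring.
rewrite pmulr_rge0 // subr_ge0 -exprMn in ge0.
by rewrite -(@ler_pXn2r _ 2) // ?nnegrE // mulr_ge0 // ltW.
Qed.

Lemma ell2_submod_closed : submod_closed ell2_pred.
Proof.
split.
  apply/ell2_predP; exists 1 => // N h; rewrite big1 ?mulr_ge0 ?exprn_ge0 ?ler0c //.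
  by move=> n _; rewrite (star0 A h : star ((0 : nat -> A^o) n) h = 0) normr0 expr0n.
move=> c a b /ell2_predP[K K0 aK] /ell2_predP[L L0 bL]; apply/ell2_predP.
have [M0 cM] := opnormP (star c); set M := opnorm (star c) in M0 cM.
exists ((K * M ^+ 2 + L) *+ 2).
  by rewrite pmulrn_rgt0 // ltr_wpDl // mulr_ge0 ?sqr_ge0 // ltW.
move=> N h.
apply: (@le_trans _ _ (\sum_(0 <= n < N)
   (`|star (a n) (star c h)| ^+ 2 + `|star (b n) h| ^+ 2) *+ 2)).
  apply: ler_sum => n _; rewrite !fctE starD starM.
  set x := star _ _; set y := star _ _.
  apply: (@le_trans _ _ ((`|x| + `|y|) ^+ 2)).
    by rewrite lerXn2r ?nnegrE ?addr_ge0 ?ler_normD.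
  rewrite -subr_ge0 (_ : _ - _ = (`|x| - `|y|) ^+ 2); last by ring.
  by rewrite real_exprn_even_ge0 // rpredB ?normr_real.
rewrite sumrMnl big_split /= rmorphMn /= mulrnAl lerMn2r /=.
rewrite rmorphD rmorphM /= mulrDl; apply: lerD => //.
apply: (le_trans (aK N _)); rewrite -mulrA ler_wpM2l ?ler0c ?(ltW K0) //.
by rewrite rmorphXn /= -exprMn lerXn2r ?nnegrE ?mulr_ge0 ?ler0c.
Qed.

Record ell2 := Ell2 { ell2_fun :> nat -> A^o; _ : ell2_fun \in ell2_pred }.

HB.instance Definition _ := [isSub for ell2_fun].
HB.instance Definition _ := gen_eqMixin ell2.
HB.instance Definition _ := gen_choiceMixin ell2.
HB.instance Definition _ := GRing.isSubmodClosed.Build _ _ ell2_pred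
  ell2_submod_closed.
HB.instance Definition _ := [SubChoice_isSubLmodule of ell2 by <:].

(* For a and b in ell2 this series does converge strongly, so that the default
   value of strong_sum plays no role. *)
Definition ell2_dot (a b : ell2) : A := strong_sum (fun n => a n * star (b n)).

Lemma ell2_e_subproof (n : nat) :
  (fun k => if k == n then 1 else 0) \in ell2_pred.
Proof.
apply/ell2_predP; have [M0 eM] := opnormP (star (1 : A)).
set M := opnorm _ in M0 eM; exists (M ^+ 2 + 1); first by rewrite ltr_wpDl ?sqr_ge0.
move=> N h; apply: (@le_trans _ _ (\sum_(0 <= k < N | k == n) `|star (1 : A) h| ^+ 2)).
  rewrite [leRHS]big_mkcond /=; apply: ler_sum => k _; case: ifP => // _.
  by rewrite star0 normr0 expr0n.
apply: (@le_trans _ _ (`|star (1 : A) h| ^+ 2)).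
  by rewrite big_nat1_eq; case: ifP => // _; rewrite exprn_ge0.
rewrite rmorphD rmorph1 mulrDl mul1r -[leLHS]addr0 lerD ?exprn_ge0 //.
by rewrite rmorphXn /= -exprMn lerXn2r ?nnegrE ?mulr_ge0 ?ler0c.
Qed.

Definition ell2_e (n : nat) : ell2 := Ell2 (ell2_e_subproof n).

Definition ell2_norm : ell2 -> R := inner_norm ell2_dot.

End StrongEll2.
Arguments ell2 {R H} A.
Arguments ell2_e {R H} A n.

(* Main.v *)
(** A bounded module map of norm at most M satisfies <Ta, Ta> <= M^2 <a, a> as
    operators: conjugating by b close to (<a, a> + eta)^(-1/2), which Newton's
    iteration produces inside A, turns the norm inequality into an operator
    inequality.

    If (x_n) is a weak frame, the analysis map U y = (<y, x_n>)_n has an adjoint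
    T because X is self-dual, T e^(n) = x_n, and T U is inverted by a Neumann
    series, so T is onto.

    Conversely, let T be bounded and onto with T e^(n) = x_n. The operator
    inequality makes <y, T a> depend strongly continuously on the truncations of
    a, so <y, T a> = <U y, a>, and it bounds U above. Surjectivity and uniform
    boundedness give |y| <= K |U y|, and a second conjugation argument upgrades
    this to <y, y> <= K^2 <U y, U y>. The second statement follows by composing
    T with R. *)

Require Import Defs.
From HB Require Import structures.
From mathcomp Require Import all_boot all_order all_algebra complex ring lra.
From mathcomp Require Import all_classical all_reals all_analysis.

Set Implicit Arguments.
Unset Strict Implicit.
Unset Printing Implicit Defensive.
Import Order.TTheory GRing.Theory Num.Theory numFieldNormedType.Exports.
Local Open Scope classical_set_scope.
Local Open Scope complex_scope.
Local Open Scope ring_scope.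

(** The hypotheses bound norms, whereas the frame inequalities compare operators; the norm of
    [<y, y>] alone says nothing about its form at a given vector. Only the module action recovers
    that information, because [b] may be chosen to suit the single element at hand. Norm bounds also
    fail for limits in [ell2]: truncations approach an element strongly, in general not in norm. All
    operator inequalities are therefore tested at a fixed vector [h], where the inner product of the
    module becomes a positive semidefinite real form. Cauchy-Schwarz and absorption arguments are
    then scalar, and their constants do not depend on [h]. The unit of [A] may be a proper
    projection of [H], so invertibility and inverse square roots are meant relative to that unit.
    The lower bound for [U] comes from a gliding hump built inside [X], whose completeness is part
    of its structure. *)

(** * The real inner product of H, and convergence of vectors *)

Section RealDot.
Context (R : realType) (H : hilbertType R).
Implicit Types h k l : H.

(** The real part suffices: forms of self-adjoint operators are real, and a vector is determined by
    its real products with all vectors. *)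
Definition rdot h k : R := complex.Re (hdot h k).
Definition nrm h : R := complex.Re `|h|.

Lemma nrmE h : `|h| = (nrm h)%:C.
Proof. by rewrite /nrm RRe_real // normr_real. Qed.

Lemma nrm_ge0 h : 0 <= nrm h.
Proof. by rewrite -lecR -nrmE normr_ge0. Qed.

Lemma rdot_nrm h : rdot h h = nrm h ^+ 2.
Proof. by rewrite /rdot hdot_norm nrmE -rmorphXn. Qed.

Lemma rdot_ge0 h : 0 <= rdot h h.
Proof. by rewrite rdot_nrm sqr_ge0. Qed.

Lemma rdotC h k : rdot h k = rdot k h.
Proof. by rewrite /rdot hdotC; case: (hdot k h). Qed.

Lemma rdotDl h k l : rdot (h + k) l = rdot h l + rdot k l.
Proof. by rewrite /rdot hdotDl; case: (hdot h l); case: (hdot k l). Qed.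

Lemma rdotBl h k l : rdot (h - k) l = rdot h l - rdot k l.
Proof. by rewrite /rdot hdotBl; case: (hdot h l); case: (hdot k l). Qed.

Lemma rdotZl (r : R) h k : rdot (r%:C *: h) k = r * rdot h k.
Proof.
by rewrite /rdot hdotZl; case: (hdot h k) => a b /=; rewrite mul0r subr0.
Qed.

Lemma rdotBr h k l : rdot l (h - k) = rdot l h - rdot l k.
Proof. by rewrite !(rdotC l) rdotBl. Qed.

Lemma rdotZr (r : R) h k : rdot k (r%:C *: h) = r * rdot k h.
Proof. by rewrite !(rdotC k) rdotZl. Qed.

Lemma rdot0l h : rdot 0 h = 0.
Proof. by rewrite /rdot hdot0l. Qed.

Lemma rdot0r h : rdot h 0 = 0.
Proof. by rewrite rdotC rdot0l. Qed.

Lemma rdot_suml (I : Type) (s : seq I) (P : pred I) (F : I -> H) k :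
  rdot (\sum_(i <- s | P i) F i) k = \sum_(i <- s | P i) rdot (F i) k.
Proof.
by apply: (big_morph (fun h => rdot h k) _ (rdot0l k)) => x y; exact: rdotDl.
Qed.

Lemma nrm_le_sqr h (K : R) : 0 <= K -> rdot h h <= K ^+ 2 -> nrm h <= K.
Proof.
move=> K0; rewrite rdot_nrm => le; rewrite -(@ler_pXn2r _ 2) // ?nnegrE //.
exact: nrm_ge0.
Qed.

Lemma nrmZ (r : R) h : 0 <= r -> nrm (r%:C *: h) = r * nrm h.
Proof.
move=> r0; apply/eqP; rewrite -(@eqrXn2 _ 2) ?nrm_ge0 ?mulr_ge0 ?nrm_ge0 //.
by rewrite -rdot_nrm rdotZl rdotZr rdot_nrm; apply/eqP; ring.
Qed.

Lemma nrmB h k : nrm (h - k) = nrm (k - h).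
Proof. by rewrite /nrm distrC. Qed.

Lemma nrm_triangle h k : nrm (h + k) <= nrm h + nrm k.
Proof. by rewrite -lecR rmorphD /= -!nrmE ler_normD. Qed.

Lemma rdot_AMGM (s : R) h k : 0 < s ->
  rdot h k <= (s * rdot h h + s^-1 * rdot k k) / 2.
Proof.
move=> s0; have := rdot_ge0 (s%:C *: h - k).
rewrite rdotBl !rdotBr !rdotZl !rdotZr (rdotC k h) => le.
have sV : s * s^-1 = 1 by rewrite divff // gt_eqF.
have V0 : 0 < s^-1 by rewrite invr_gt0.
move: (rdot h h) (rdot h k) (rdot k k) le => a b c le.
have {le} := mulr_ge0 (ltW V0) le.
move: (s^-1) sV => t sV le.
(* An identity in independent [s] and [t]; its last summand vanishes once [s * t = 1]. *)
have -> : (s * a + t * c) / 2 = b + t * (s * (s * a) - s * b - (s * b - c)) / 2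
    + (1 - s * t) * (s * a - 2 * b) / 2 by field.
rewrite sV; lra.
Qed.

Lemma rdot_CS h k : rdot h k <= nrm h * nrm k.
Proof.
have [h0|h0] := eqVneq (nrm h) 0.
  have : h = 0 by apply/eqP; rewrite -normr_eq0 nrmE h0.
  by move=> ->; rewrite rdot0l mulr_ge0 // nrm_ge0.
have [k0|k0] := eqVneq (nrm k) 0.
  have : k = 0 by apply/eqP; rewrite -normr_eq0 nrmE k0.
  by move=> ->; rewrite rdot0r mulr_ge0 // nrm_ge0.
have hp : 0 < nrm h by rewrite lt_def h0 nrm_ge0.
have kp : 0 < nrm k by rewrite lt_def k0 nrm_ge0.
(* The weight [nrm k / nrm h] makes the two terms of the mean equal. *)
have := rdot_AMGM h k (divr_gt0 kp hp).
rewrite !rdot_nrm (_ : (_ + _) / 2 = nrm h * nrm k) //.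
by field; rewrite h0 k0.
Qed.

Lemma rdot_abs_CS h k : `|rdot h k| <= nrm h * nrm k.
Proof.
rewrite ler_norml rdot_CS andbT lerNl.
have := rdot_CS (- h) k.
rewrite -[X in rdot X]sub0r rdotBl rdot0l sub0r => /le_trans; apply.
by rewrite /nrm normrN.
Qed.

Lemma bounded_byE (M : R) (f : H -> H) :
  bounded_by M f <-> forall h, nrm (f h) <= M * nrm h.
Proof.
by split=> fM h; have := fM h; rewrite !nrmE -rmorphM /= lecR.
Qed.

Lemma nrm_bop (S : bop H) h : nrm (S h) <= opnorm S * nrm h.
Proof. by have [_ /bounded_byE] := opnormP S. Qed.

Lemma cvg_nrm (u : nat -> H) l :
  (u n @[n --> \oo] --> l) <->
  forall e : R, 0 < e -> exists N, forall n, (N <= n)%N -> nrm (u n - l) < e.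
Proof.
split=> [/cvgrPdist_lt ul e e0|ul].
  have e0' : (0 : R[i]) < e%:C by rewrite ltcR.
  have [N _ NP] := ul _ e0'; exists N => n /NP /=.
  by rewrite distrC nrmE ltcR.
apply/cvgrPdist_lt => e e0.
have er : e = (complex.Re e)%:C by rewrite RRe_real // gtr0_real.
have [|N NP] := ul (complex.Re e); first by rewrite -ltcR -er.
by exists N => // n /NP /=; rewrite er distrC nrmE ltcR.
Qed.

Lemma cvg_rdot (u : nat -> H) l k :
  u n @[n --> \oo] --> l -> rdot (u n) k @[n --> \oo] --> rdot l k.
Proof.
move=> /cvg_nrm ul; apply/cvgrPdist_lt => e e0.
have k1 : 0 < nrm k + 1 by rewrite ltr_wpDl // nrm_ge0.
have [|N NP] := ul (e / (nrm k + 1)); first by rewrite divr_gt0.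
exists N => // n /NP /= {}NP; rewrite distrC -rdotBl.
apply: le_lt_trans (rdot_abs_CS _ _) _.
apply: (@le_lt_trans _ _ (nrm (u n - l) * (nrm k + 1))).
  by rewrite ler_wpM2l ?nrm_ge0 // lerDl.
by rewrite -ltr_pdivlMr.
Qed.

Lemma rdot_ext h k : (forall l, rdot h l = rdot k l) -> h = k.
Proof.
move=> hk; apply/eqP; rewrite -subr_eq0 -normr_eq0 nrmE.
have := rdot_nrm (h - k); rewrite rdotBl hk subrr => /esym/eqP.
by rewrite sqrf_eq0 => /eqP ->.
Qed.

Lemma hilbert_cauchy (u : nat -> H) :
  (forall e : R, 0 < e -> exists N, forall m n, (N <= m)%N -> (m <= n)%N ->
     nrm (u n - u m) < e) ->
  exists l : H, u n @[n --> \oo] --> l.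
Proof.
move=> uC; suff /cauchy_cvg cv : cauchy (u n @[n --> \oo]).
  by exists (lim (u n @[n --> \oo])).
apply/cauchyP => e e0.
have er : e = (complex.Re e)%:C by rewrite RRe_real // gtr0_real.
have [|N NP] := uC (complex.Re e); first by rewrite -ltcR -er.
exists (u N); exists N => // n /= Nn.
by rewrite -ball_normE /= er distrC nrmE ltcR NP.
Qed.

End RealDot.

(** * Scalar inequalities obtained from vanishing errors and from discriminants *)

Section Limits.
Context (R : realType).
Implicit Types x y z r : R.

Lemma le_of_geometric_error x y z r : 0 <= r < 1 ->
  (forall n, x <= y + r ^+ n.+1 * z) -> x <= y.
Proof.
move=> /andP[r0 r1] le.
have cv : y + r ^+ n.+1 * z @[n --> \oo] --> y + 0 * z.
  apply: cvgD; first exact: cvg_cst.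
  apply: cvgM; last exact: cvg_cst.
  by rewrite (cvg_shiftS (fun n => r ^+ n)); apply: cvg_expr; rewrite ger0_norm.
rewrite mul0r addr0 in cv.
apply: (ler_cvg_to (cvg_cst x) cv).
by apply: nearW => n /=; exact: le.
Qed.

Lemma le_of_linear_error x y z : (forall e, 0 < e -> x <= y + e * z) -> x <= y.
Proof.
move=> le; apply/ler_addgt0Pr => e e0.
have z0 : 0 < `|z| + 1 by rewrite ltr_wpDl.
apply: (le_trans (le (e / (`|z| + 1)) (divr_gt0 e0 z0))).
rewrite lerD2l mulrAC ler_pdivrMr // ler_pM2l //.
by rewrite (le_trans (ler_norm z)) // lerDl.
Qed.

Lemma discriminant_le (a b c : R) : 0 <= a -> 0 <= c ->
  (forall t : R, 0 <= t ^+ 2 * a - 2 * t * b + c) -> b ^+ 2 <= a * c.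
Proof.
move=> a0 c0 q; have [a_eq0|an0] := eqVneq a 0.
  have [->|bn0] := eqVneq b 0; first by rewrite expr0n mulr_ge0.
  (* With [a = 0] the polynomial is linear in [t], and this [t] gives it the value -1. *)
  have := q ((c + 1) / (2 * b)); rewrite a_eq0 mulr0 sub0r.
  have -> : 2 * ((c + 1) / (2 * b)) * b = c + 1 by field.
  lra.
have ap : 0 < a by rewrite lt_def an0.
have := q (b / a).
have -> : (b / a) ^+ 2 * a - 2 * (b / a) * b + c = (a * c - b ^+ 2) / a.
  by field.
by rewrite pmulr_lge0 ?invr_gt0 // subr_ge0.
Qed.

End Limits.

(** * Forms and norms of elements of A, and approximate inverse square roots *)

Section VNTheory.
Context (R : realType) (H : hilbertType R) (A : vnalg H).
Implicit Types (a b c p q s : A) (h k : H).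

Lemma vnDE a b h : (a + b) h = a h + b h. Proof. by []. Qed.
Lemma vnBE a b h : (a - b) h = a h - b h. Proof. by []. Qed.
Lemma vnME a b h : (a * b) h = a (b h). Proof. by []. Qed.
Lemma vnZE (z : R[i]) a h : (z *: a : A) h = z *: a h. Proof. by []. Qed.
Lemma vn0E h : (0 : A) h = 0. Proof. by []. Qed.

Lemma vn_addr a h k : a (h + k) = a h + a k.
Proof. exact: (linearD (vn_val a)). Qed.
Lemma vn_subr a h k : a (h - k) = a h - a k.
Proof. exact: (linearB (vn_val a)). Qed.
Lemma vn_scaler a (z : R[i]) h : a (z *: h) = z *: a h.
Proof. exact: (linearZ_LR (vn_val a)). Qed.

Lemma vn_ext a b : (forall h, a h = b h) -> a = b.
Proof. by move=> ab; apply/val_inj/bop_ext. Qed.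

Lemma vn_rdot_ext a b : (forall h k, rdot (a h) k = rdot (b h) k) -> a = b.
Proof. by move=> ab; apply: vn_ext => h; apply: rdot_ext => k; exact: ab. Qed.

Lemma rdot_star a h k : rdot (a h) k = rdot h (star a k).
Proof. by rewrite /rdot starP. Qed.

Lemma starEK a : star (star a) = a.
Proof. by apply: vn_ext => h; rewrite starK. Qed.

Lemma rdot_starl a h k : rdot (star a h) k = rdot h (a k).
Proof. by rewrite rdot_star starEK. Qed.

Lemma starED a b : star (a + b) = star a + star b.
Proof. by apply: vn_ext => h; rewrite starD. Qed.

Lemma starEM a b : star (a * b) = star b * star a.
Proof. by apply: vn_ext => h; rewrite starM. Qed.

Lemma starEZ (r : R) a : star (r%:C *: a) = r%:C *: star a :> A.
Proof.
apply: vn_rdot_ext => h k.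
by rewrite rdot_starl !vnZE rdotZl rdotZr rdot_starl.
Qed.

Lemma starEB a b : star (a - b) = star a - star b.
Proof.
apply: vn_rdot_ext => h k.
by rewrite rdot_starl !vnBE rdotBr rdotBl !rdot_starl.
Qed.

Lemma star1 : star (1 : A) = 1.
Proof. by rewrite -[LHS]mulr1 -{2}(starEK 1) -starEM mulr1 starEK. Qed.

Lemma rdot_sa a h k : star a = a -> rdot (a h) k = rdot h (a k).
Proof. by move=> {2}<-; rewrite rdot_star. Qed.

Lemma rdot_mulstar a h : rdot ((a * star a) h) h = rdot (star a h) (star a h).
Proof. by rewrite vnME rdot_star. Qed.

Lemma op_leP a b : star a = a -> star b = b ->
  (op_le a b <-> forall h, rdot (a h) h <= rdot (b h) h).
Proof.
move=> sa sb; have sba : star (b - a) = b - a by rewrite starEB sa sb.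
split=> le h.
  by have := le h; rewrite lecE => /andP[_ {}le]; rewrite -subr_ge0 -rdotBl.
rewrite lecE; apply/andP; split; last first.
  have := le h; rewrite -subr_ge0 -rdotBl; exact.
have : hdot ((b - a) h) h = (hdot ((b - a) h) h)^*%R.
  by rewrite {1}(starP (b - a)) sba hdotC.
by case: (hdot _ _) => x y /= [] yN; apply/eqP; lra.
Qed.

(** The converse direction is Cauchy-Schwarz for the form [(a h, k)]: at [a h] and [h] it gives
    [|a h|^4 <= (a (a h), a h) (a h, h)], which is at most [K |a h|^2 K |h|^2]. *)
Lemma opnorm_pos a (K : R) : star a = a -> (forall h, 0 <= rdot (a h) h) ->
  0 <= K ->
  (opnorm a <= K <-> forall h, rdot (a h) h <= K * rdot h h).
Proof.
move=> sa a0 K0; split=> [aK h|aK].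
  apply: (le_trans (rdot_CS _ _)); rewrite rdot_nrm expr2 mulrA.
  rewrite ler_wpM2r ?nrm_ge0 //; apply: (le_trans (nrm_bop a h)).
  by rewrite ler_wpM2r ?nrm_ge0.
apply: opnorm_le => //; apply/bounded_byE => h; apply: nrm_le_sqr.
  by rewrite mulr_ge0 // nrm_ge0.
have CS : rdot (a h) (a h) ^+ 2 <= rdot (a (a h)) (a h) * rdot (a h) h.
  apply: discriminant_le => // t.
  have := a0 (t%:C *: a h - h).
  rewrite vn_subr vn_scaler rdotBl !rdotBr !rdotZl !rdotZr.
  rewrite (rdot_sa (a h) h sa); lra.
have [x0|x0] := eqVneq (rdot (a h) (a h)) 0.
  by rewrite x0 sqr_ge0.
have xp : 0 < rdot (a h) (a h) by rewrite lt_def x0 rdot_ge0.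
have K1 := aK (a h); have K2 := aK h; rewrite exprMn -rdot_nrm.
have a1 := a0 h; have h0 := rdot_ge0 h.
rewrite -(ler_pM2l xp) -expr2; apply: (le_trans CS).
apply: (@le_trans _ _ (K * rdot (a h) (a h) * (K * rdot h h))).
  by apply: ler_pM.
by rewrite le_eqVlt; apply/orP; left; apply/eqP; ring.
Qed.

(** The unit acts on [H] as a projection, possibly not the identity, that can be absorbed on either
    side of any element of [A]. *)
Lemma vn_one_idem h : (1 : A) ((1 : A) h) = (1 : A) h.
Proof. by rewrite -vnME mulr1. Qed.

Lemma vn_mul1E a h : (1 : A) (a h) = a h.
Proof. by rewrite -vnME mul1r. Qed.

Lemma vn_mulr1E a h : a ((1 : A) h) = a h.
Proof. by rewrite -vnME mulr1. Qed.

Lemma rdot_one h : rdot ((1 : A) h) h = rdot ((1 : A) h) ((1 : A) h).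
Proof. by rewrite [RHS]rdot_sa ?star1 // vn_one_idem rdot_sa ?star1. Qed.

Lemma rdot_one_le h : rdot ((1 : A) h) h <= rdot h h.
Proof.
have := rdot_ge0 (h - (1 : A) h).
by rewrite rdotBl !rdotBr -rdot_one (rdotC h); lra.
Qed.

(* Newton's iteration a <- a (1 + f), where 2 f = 1 - a (1 - s) a is the error,
   replaces 2 f by 3 f^2 + 2 f^3. *)
Lemma approx_inverse_sqrt s (r : R) : star s = s -> 0 <= r < 1 ->
  (forall h, nrm (s h) <= r * nrm h) ->
  forall n, exists a f : A, [/\ star a = a, GRing.comm a s,
    a * a * (1 - s) = 1 - f - f &
    forall h, nrm (f h) <= r ^+ n.+1 / 2 * nrm h].
Proof.
move=> ss /andP[r0 r1] sr n.
(* The induction must also carry that [f] is self-adjoint and commutes with [s] and [a]: this keeps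
   [a * (1 + f)] self-adjoint and lets the factors be regrouped. *)
suff [a [f [? ? ? []]]] : exists a f : A, [/\ star a = a, GRing.comm a s,
    a * a * (1 - s) = 1 - f - f,
    [/\ star f = f, GRing.comm f s & GRing.comm f a] &
    forall h, nrm (f h) <= r ^+ n.+1 / 2 * nrm h].
  by exists a, f; split.
have half (g : A) : (2^-1)%:C *: g + (2^-1)%:C *: g = g.
  apply: vn_rdot_ext => h k; rewrite vnDE !vnZE rdotDl rdotZl; lra.
have comm_half (g b : A) : GRing.comm g b -> GRing.comm ((2^-1)%:C *: g) b.
  rewrite /GRing.comm => gb; apply: vn_ext => h.
  by rewrite !vnME !vnZE vn_scaler -!vnME gb.
elim: n => [|n [a [f [sa as_ aas [sf fs fa] fr]]]].
  exists 1, ((2^-1)%:C *: s); split.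
  - exact: star1.
  - by apply: commr_sym; exact: commr1.
  - by rewrite !mul1r -addrA -opprD half.
  - by split; rewrite ?starEZ ?ss //; apply: comm_half => //; exact: commr1.
  - move=> h; rewrite vnZE nrmZ ?invr_ge0 // expr1 (mulrC r) -mulrA.
    by rewrite ler_wpM2l // invr_ge0.
have cf1 (x : A) : GRing.comm f x -> GRing.comm (1 + f) x.
  by move=> fx; apply: commr_sym; apply: commrD; [exact: commr1 | exact/commr_sym].
(* From [(1 - 2 f) (1 + f)^2 = 1 - 3 f^2 - 2 f^3]; the new error is half of [g]. *)
pose g := f * f + f * f + f * f + f * f * f + f * f * f.
have cg (x : A) : GRing.comm f x -> GRing.comm g x.
  move=> /commr_sym xf; apply: commr_sym.
  by do !apply: commrD; do ?apply: commrM.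
exists (a * (1 + f)), ((2^-1)%:C *: g); split.
- by rewrite starEM starED star1 sf sa; apply: cf1.
- apply: commr_sym; apply: commrM; first exact: commr_sym.
  by apply: commr_sym; apply: cf1.
- rewrite -addrA -opprD half.
  have -> : a * (1 + f) * (a * (1 + f)) * (1 - s) =
            a * a * (1 - s) * ((1 + f) * (1 + f)).
    have -> : a * (1 + f) * (a * (1 + f)) = a * a * ((1 + f) * (1 + f)).
      by rewrite mulrA -(mulrA a (1 + f) a) (cf1 _ fa) !mulrA.
    rewrite -!mulrA; congr (_ * (_ * _)).
    have c1 : GRing.comm (1 + f) (1 - s).
      by apply: commrB; [exact: commr1 | exact: cf1].
    by rewrite c1 mulrA c1 mulrA.
  rewrite aas /g; apply: vn_rdot_ext => h k.
  rewrite !(mulrDl, mulrDr, mulrBl, mul1r, mulr1, mulNr, mulrN, mulrA).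
  have vnN (x : A) : (- x) h = - x h by [].
  rewrite !(vnDE, vnN) -![in RHS]mulrA.
  have rN (x y : H) : rdot (- x) y = - rdot x y.
    by rewrite -[- x]sub0r rdotBl rdot0l sub0r.
  rewrite ?mulrA !(rdotDl, rN); lra.
- split.
  + rewrite starEZ; congr (_ *: _).
    by rewrite /g !starED !starEM sf !mulrA.
  + by apply: comm_half; apply: cg.
  + apply: comm_half; apply: cg; apply: commrM => //.
    by apply: commr_sym; apply: cf1.
move=> h; set t := r ^+ n.+1 in fr.
have t0 : 0 <= t by rewrite exprn_ge0.
have t1 : t <= r by rewrite /t exprS ler_piMr // exprn_ile1 // ltW.
have hn := nrm_ge0 h.
have f1 := fr h; have n1 := nrm_ge0 (f h).
have : 0 <= t / 2 by rewrite divr_ge0.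
set u := t / 2 => u0; rewrite -/u in f1.
have f2 : nrm (f (f h)) <= u ^+ 2 * nrm h.
  by apply: (le_trans (fr _)); rewrite -/u expr2 -mulrA ler_wpM2l.
have f3 : nrm (f (f (f h))) <= u ^+ 3 * nrm h.
  by apply: (le_trans (fr _)); rewrite -/u (exprS _ 2) -mulrA ler_wpM2l.
rewrite vnZE nrmZ ?invr_ge0 // /g !vnDE !vnME.
set x := f (f h) in f2 *; set y := f x in f3 *.
have le : nrm (x + x + x + y + y) <= nrm x + nrm x + nrm x + nrm y + nrm y.
  by do 4!(apply: (le_trans (nrm_triangle _ _)); rewrite lerD2r).
(* With [u = t / 2] the left side is [(3 t^2 + t^3) / 4], at most [t^2 <= r t]. A geometric rate is
   enough, so the quadratic one is given away. *)
have bd : u ^+ 2 * 3 + u ^+ 3 * 2 <= r ^+ n.+2.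
  rewrite (exprS r) -/t.
  have : t * t <= r * t by rewrite ler_wpM2r.
  have : t * (t * t) <= t * t.
    rewrite ler_piMl // ?mulr_ge0 //; exact: le_trans t1 (ltW r1).
  rewrite /u !exprS expr0; lra.
have := ler_wpM2r hn bd; lra.
Qed.

Lemma approx_inverse_sqrt_bound p (r : R) n (s := 1 - p) :
  star p = p -> 0 <= r < 1 -> (forall h, nrm (s h) <= r * nrm h) ->
  exists a : A, star a = a /\
    exists e : A, [/\ a * p * a = 1 - e, a * a * p = 1 - e &
      forall h, nrm (e h) <= r ^+ n.+1 * nrm h].
Proof.
move=> sp r01 sr.
have ss : star s = s by rewrite starEB star1 sp.
have [a [f [sa as_ aas fr]]] := approx_inverse_sqrt ss r01 sr n.
have ps : p = 1 - s by rewrite /s opprB addrC subrK.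
have e1 : a * a * p = 1 - (f + f) by rewrite {1}ps aas opprD addrA.
exists a; split => //; exists (f + f); split => //.
  rewrite -e1 -!mulrA; congr (_ * _).
  rewrite ps; apply: commr_sym; apply: commrB; [exact: commr1 | exact: as_].
move=> h; rewrite vnDE; apply: (le_trans (nrm_triangle _ _)).
by have := fr h; lra.
Qed.

End VNTheory.

(** * From inequalities under conjugation to operator inequalities *)

Section Paschke.
Context (R : realType) (H : hilbertType R) (A : vnalg H).
Implicit Types (a b p q : A) (h k : H).

(* Tested on b close to (p + eta)^(-1/2), the hypothesis compares q with
   M (p + eta). *)
Lemma op_le_of_conjugates p q (M : R) : 0 <= M ->
  star p = p -> (forall h, 0 <= rdot (p h) h) ->
  star q = q -> (forall h, 0 <= rdot (q h) h) ->
  (forall b (K : R), 0 <= K ->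
     (forall h, rdot (p (star b h)) (star b h) <= K * rdot h h) ->
     forall h, rdot (q (star b h)) (star b h) <= M * K * rdot h h) ->
  forall h, rdot (q h) h <= M * rdot (p h) h.
Proof.
move=> M0 sp p0 sq q0 pq h.
apply: (@le_of_linear_error _ _ _ (M * rdot h h)) => eta eta0.
set N := opnorm p; have N0 : 0 <= N by have [] := opnormP p.
(* Dividing [p + eta] by this bound of its norm places [P] between [eta / d] and the unit, so
   [s = 1 - P] is positive with norm at most [r < 1], as the iteration requires. *)
set d := N + eta; have d0 : 0 < d by rewrite /d ltr_wpDl.
have dV : d * d^-1 = 1 by rewrite divff // gt_eqF.
have V0 : 0 < d^-1 by rewrite invr_gt0.
pose P : A := (d^-1)%:C *: (p + eta%:C *: (1 : A)).
have sP : star P = P by rewrite /P starEZ starED starEZ sp star1.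
have PE k l : rdot (P k) l = d^-1 * (rdot (p k) l + eta * rdot ((1 : A) k) l).
  by rewrite /P vnZE vnDE vnZE rdotZl rdotDl rdotZl.
pose s : A := 1 - P.
have sE k : rdot (s k) k = rdot ((1 : A) k) k -
    d^-1 * (rdot (p k) k + eta * rdot ((1 : A) k) k).
  by rewrite /s vnBE rdotBl PE.
have one0 k : 0 <= rdot ((1 : A) k) k by rewrite rdot_one rdot_ge0.
have pN k : rdot (p k) k <= N * rdot ((1 : A) k) k.
  have -> : rdot (p k) k = rdot (p ((1 : A) k)) ((1 : A) k).
    by rewrite vn_mulr1E -{1}star1 -rdot_star vn_mul1E.
  by rewrite rdot_one; apply: (opnorm_pos sp p0 N0).1.
set r := 1 - d^-1 * eta.
have r01 : 0 <= r < 1.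
  apply/andP; split; last by rewrite ltrBlDr ltrDl mulr_gt0.
  by rewrite subr_ge0 mulrC ler_pdivrMr // mul1r /d lerDr.
have sP' : star s = s by rewrite /s starEB sP star1.
have s0 k : 0 <= rdot (s k) k.
  have := ler_wpM2l (ltW V0) (pN k); have := one0 k; rewrite sE.
  move: (rdot _ k) (rdot _ k) => x y y0 le.
  have : d^-1 * N * y + d^-1 * eta * y = y.
    by rewrite -mulrDl -mulrDr -/d (mulrC d^-1) dV mul1r.
  lra.
have sr k : rdot (s k) k <= r * rdot k k.
  have := mulr_ge0 (ltW V0) (p0 k); rewrite sE => p1.
  apply: (@le_trans _ _ (r * rdot ((1 : A) k) k)); first by rewrite /r; lra.
  by case/andP: r01 => r0 _; rewrite ler_wpM2l ?rdot_one_le.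
have snrm k : nrm (s k) <= r * nrm k.
  apply: (le_trans (nrm_bop s k)); rewrite ler_wpM2r ?nrm_ge0 //.
  by apply: (opnorm_pos sP' s0 _).2 => //; case/andP: r01.
set u := rdot h (P h).
have uE : M * d * u = M * rdot (p h) h + M * eta * rdot ((1 : A) h) h.
  rewrite /u rdotC PE mulrA -(mulrA M) dV; lra.
apply: (@le_trans _ _ (M * d * u)); last first.
  rewrite uE lerD2l mulrCA mulrA ler_wpM2l ?rdot_one_le // mulr_ge0 //.
  exact: ltW.
pose w := nrm h * nrm (P h).
have w0 : 0 <= w by rewrite mulr_ge0 ?nrm_ge0.
(* The factor of the error is what [(1 + t) (u + t w)] leaves beyond [u] after [t^2 <= t], together
   with the cross term of [q]. *)
apply: (@le_of_geometric_error _ _ _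
  (M * d * (u + w + w) + 2 * (nrm h * nrm (q h))) r r01) => n.
have [a [sa [e [apa aap er]]]] := approx_inverse_sqrt_bound n sP r01 snrm.
set t := r ^+ n.+1 in er *.
have t0 : 0 <= t by rewrite exprn_ge0 //; case/andP: r01.
have t1 : t <= 1 by rewrite exprn_ile1 //; case/andP: r01 => // _ /ltW.
have eb k l : `|rdot (e k) l| <= t * (nrm k * nrm l).
  apply: (le_trans (rdot_abs_CS _ _)).
  by rewrite mulrA ler_wpM2r ?nrm_ge0.
have K0 : 0 <= (1 + t) * d by rewrite mulr_ge0 ?(ltW d0) // addr_ge0.
have pK k : rdot (p (star a k)) (star a k) <= (1 + t) * d * rdot k k.
  rewrite sa; apply: (@le_trans _ _ (d * rdot (P (a k)) (a k))).
    by rewrite PE mulrA dV mul1r lerDl mulr_ge0 // ltW.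
  rewrite -mulrA mulrCA ler_wpM2l ?(ltW d0) //.
  rewrite -rdot_sa // -!vnME ?mulrA apa vnBE rdotBl mulrDl mul1r.
  apply: lerD; first exact: rdot_one_le.
  by have /ler_normlP[] := eb k k; rewrite rdot_nrm expr2.
(* Since [a * a * P = 1 - e], conjugating by [a] at this [k] evaluates [q] at [h] up to [e h], while
   [|k|^2] is close to [(h, P h)]. *)
pose k := a (P h).
have akE : star a k = (1 : A) h - e h by rewrite sa /k -!vnME aap vnBE.
have kk : rdot k k <= u + t * w.
  rewrite {1}/k rdot_star akE rdotBr -{1}star1 -rdot_star vn_mul1E.
  by rewrite rdotC -/u (rdotC (P h)); have /ler_normlP[] := eb h (P h);
    rewrite -/w => e1 e2; lra.
have q1 l : rdot (q l) ((1 : A) h) = rdot (q l) h.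
  by rewrite -{1}star1 -rdot_star vn_mul1E.
have := pq a _ K0 pK k; rewrite akE vn_subr rdotBl !rdotBr vn_mulr1E.
rewrite !q1 [rdot (q (e h)) h]rdot_sa // (rdotC (q h) (e h)) => le.
have qe := q0 (e h); have /ler_normlP[eq1 eq2] := eb h (q h).
have kM : M * ((1 + t) * d) * rdot k k <= M * ((1 + t) * d) * (u + t * w).
  by rewrite ler_wpM2l // mulr_ge0.
have tt : t * (M * d * w) * t <= t * (M * d * w) * 1.
  rewrite ler_wpM2l //; do ?apply: mulr_ge0 => //; exact: ltW.
lra.
Qed.

End Paschke.

(** * Weak and strong operator limits in A *)

Section StrongConvergence.
Context (R : realType) (H : hilbertType R) (A : vnalg H).
Implicit Types (a b c L : A) (h k : H) (u v : nat -> A).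

(** The weak operator topology, for which [star] is continuous; for the strong one it is not in
    general. *)
Definition weak_cvg u L :=
  forall h k, rdot (u n h) k @[n --> \oo] --> rdot (L h) k.

Lemma strong_weak_cvg u L : strong_cvg u L -> weak_cvg u L.
Proof. by move=> uL h k; apply: cvg_rdot; exact: uL. Qed.

Lemma weak_cvg_unique u L L' : weak_cvg u L -> weak_cvg u L' -> L = L'.
Proof.
move=> uL uL'; apply: vn_rdot_ext => h k.
exact: (cvg_unique _ (uL h k) (uL' h k)).
Qed.

Lemma weak_cvg_eq u v L : u =1 v -> weak_cvg u L -> weak_cvg v L.
Proof. by move=> /funext <-. Qed.

Lemma weak_cvg_star u L : weak_cvg u L -> weak_cvg (fun n => star (u n)) (star L).
Proof.
move=> uL h k; rewrite rdot_starl rdotC.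
by under eq_fun do rewrite rdot_starl rdotC; exact: uL.
Qed.

Lemma weak_cvgD u v L L' : weak_cvg u L -> weak_cvg v L' ->
  weak_cvg (fun n => u n + v n) (L + L').
Proof.
move=> uL vL h k; rewrite vnDE rdotDl.
by under eq_fun do rewrite vnDE rdotDl; apply: cvgD; [exact: uL|exact: vL].
Qed.

Lemma weak_cvgMl c u L : weak_cvg u L -> weak_cvg (fun n => c * u n) (c * L).
Proof.
move=> uL h k; rewrite vnME rdot_star.
by under eq_fun do rewrite vnME rdot_star; exact: uL.
Qed.

Lemma weak_cvg_le u L h (x : R) : weak_cvg u L ->
  (forall n, rdot (u n h) h <= x) -> rdot (L h) h <= x.
Proof.
move=> uL ux; apply: (ler_cvg_to (uL h h) (cvg_cst x)).
by apply: nearW => n; exact: ux.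
Qed.

Lemma weak_cvg_nondecreasing u L h : weak_cvg u L ->
  (forall m n, (m <= n)%N -> rdot (u m h) h <= rdot (u n h) h) ->
  forall n, rdot (u n h) h <= rdot (L h) h.
Proof.
move=> uL und n; apply: (ler_cvg_to (cvg_cst _) (uL h h)).
by exists n => // m /= nm; exact: und.
Qed.

Lemma strong_sumE u L : strong_cvg (series u) L -> strong_sum u = L.
Proof.
move=> uL; rewrite /strong_sum; case: xgetP => [L' _ /= uL'|/(_ L) []//].
by apply: weak_cvg_unique; exact: strong_weak_cvg.
Qed.

(** The pointwise limit is linear and inherits the bound [M], so it is an operator in the strong
    closure of [A], hence in [A]. *)
Lemma vn_strong_complete u (M : R) : 0 <= M ->
  (forall n h, nrm (u n h) <= M * nrm h) ->
  (forall h, exists l : H, u n h @[n --> \oo] --> l) ->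
  exists L : A, strong_cvg u L.
Proof.
move=> M0 uM uc; pose f h : H := projT1 (cid (uc h)).
have uf h : u n h @[n --> \oo] --> f h by rewrite /f; case: cid.
have fM h : nrm (f h) <= M * nrm h.
  apply: nrm_le_sqr; first by rewrite mulr_ge0 ?nrm_ge0.
  have := @cvg_rdot _ _ _ _ (f h) (uf h).
  move=> /ler_cvg_to /(_ (cvg_cst (M * nrm h * nrm (f h)))) le.
  have {}le : rdot (f h) (f h) <= M * nrm h * nrm (f h).
    apply: le; apply: nearW => n; apply: (le_trans (rdot_CS _ _)).
    by rewrite ler_wpM2r ?nrm_ge0.
  have [f0|f0] := eqVneq (nrm (f h)) 0.
    by rewrite rdot_nrm f0 expr0n sqr_ge0.
  have fp : 0 < nrm (f h) by rewrite lt_def f0 nrm_ge0.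
  move: le; rewrite rdot_nrm expr2 ler_pM2r // => le.
  by rewrite expr2 ler_pM ?nrm_ge0.
have flin : linear f.
  move=> z h k.
  have cv : u n (z *: h + k) @[n --> \oo] --> z *: f h + f k.
    have E : (fun n => u n (z *: h + k)) =1 (fun n => z *: u n h + u n k).
      by move=> n; rewrite vn_addr vn_scaler.
    rewrite (eq_cvg _ _ E).
    by apply: cvgD; [apply: cvgZr | ]; exact: uf.
  apply: rdot_ext => l.
  exact: (cvg_unique _ (cvg_rdot (uf _)) (cvg_rdot cv)).
have fb : f \in @bounded_linear R H.
  by rewrite inE; split => //; exists M; apply/bounded_byE.
have fA : vn_set A (Bop fb).
  apply: vn_closed => B /= Bf.
  have : {ptws, (fun n => (u n : H -> H)) @ \oo --> f}.
    by apply/pointwise_cvgP => h; exact: uf.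
  move=> /(_ _ Bf) [N _ /(_ N (leqnn N)) BN].
  exists (u N : H -> H); split => //.
  by exists (u N) => //; exact: vn_valP.
by exists (VNElt (mem_set fA : Bop fb \in vn_pred A)) => h; exact: uf.
Qed.

End StrongConvergence.

(** * The inner product of strongly square-summable sequences *)

Lemma sum_tail_lt (R : realType) (x : nat -> R) (B e : R) :
  (forall n, 0 <= x n) -> (forall n, \sum_(0 <= i < n) x i <= B) -> 0 < e ->
  exists N, forall m n, (N <= m)%N -> (m <= n)%N -> \sum_(m <= i < n) x i < e.
Proof.
move=> x0 xB e0; pose s n := \sum_(0 <= i < n) x i.
have snd : nondecreasing_seq s.
  move=> m n mn; rewrite /s (big_cat_nat (leq0n m) mn) //= lerDl.
  by apply: sumr_ge0.
have sc : cvgn s.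
  by apply: nondecreasing_is_cvgn => //; exists B => _ [n _ <-]; exact: xB.
have /cvgrPdist_lt /(_ e e0) [N _ NP] := sc.
exists N => m n Nm mn; have := NP m Nm; rewrite /= => lt.
have := nondecreasing_cvgn_le snd sc n.
have -> : s n = s m + \sum_(m <= i < n) x i.
  by rewrite /s (big_cat_nat (leq0n m) mn).
by move: lt => /ltr_normlP[]; lra.
Qed.

Section Ell2.
Context (R : realType) (H : hilbertType R) (A : vnalg H).
Implicit Types (h k : H).

Definition ell2_sqsum (a : nat -> A) N h : R :=
  \sum_(0 <= n < N) rdot (star (a n) h) (star (a n) h).

Lemma ell2_sqsumE (a : nat -> A) N h :
  \sum_(0 <= n < N) `|star (a n) h| ^+ 2 = (ell2_sqsum a N h)%:C.
Proof.
rewrite /ell2_sqsum rmorph_sum; apply: eq_bigr => n _.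
by rewrite rdot_nrm nrmE -rmorphXn.
Qed.

Lemma ell2_sqsum_series (a : nat -> A) N h :
  rdot (series (fun n => a n * star (a n)) N h) h = ell2_sqsum a N h.
Proof.
by rewrite vn_sumE rdot_suml; apply: eq_bigr => n _; rewrite rdot_mulstar.
Qed.

Lemma ell2_sqsum_le (a : nat -> A) m n h : (m <= n)%N ->
  ell2_sqsum a m h <= ell2_sqsum a n h.
Proof.
move=> mn; rewrite /ell2_sqsum (big_cat_nat (leq0n m) mn) //= lerDl.
by apply: sumr_ge0 => i _; exact: rdot_ge0.
Qed.

Lemma ell2_bounded (a : ell2 A) :
  exists2 K : R, 0 < K & forall N h, ell2_sqsum a N h <= K * rdot h h.
Proof.
case: a => a /= /ell2_predP[K K0 aK]; exists K => // N h.
have := aK N h; rewrite nrmE -rmorphXn /= -rdot_nrm -rmorphM /= -lecR.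
by move=> le; rewrite -ell2_sqsumE.
Qed.

Lemma ell2_of_bounded (a : nat -> A) (K : R) :
  (forall N h, ell2_sqsum a N h <= K * rdot h h) ->
  (a : nat -> A^o) \in @ell2_pred R H A.
Proof.
move=> aK; apply/ell2_predP; exists (`|K| + 1); first by rewrite ltr_wpDl.
move=> N h; rewrite ell2_sqsumE nrmE -rmorphXn /= -rdot_nrm -rmorphM /= lecR.
apply: (le_trans (aK N h)); rewrite ler_wpM2r ?rdot_ge0 //.
by rewrite (le_trans (ler_norm K)) // lerDl.
Qed.

(** A bounded row of operators: [(w, w)] is the sum of [(u i, star (b i) w)], and the mean
    inequality with weight [K] bounds it by half the right side plus [(w, w) / 2], which is
    absorbed. *)
Lemma block_bound (b : nat -> A) (K : R) (u : nat -> H) m n : 0 < K ->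
  (forall N h, ell2_sqsum b N h <= K * rdot h h) ->
  rdot (\sum_(m <= i < n) b i (u i)) (\sum_(m <= i < n) b i (u i)) <=
  K * \sum_(m <= i < n) rdot (u i) (u i).
Proof.
move=> K0 bK; set w := \sum_(m <= i < n) b i (u i).
have V0 : 0 < K^-1 by rewrite invr_gt0.
have bw : \sum_(m <= i < n) rdot (star (b i) w) (star (b i) w) <= K * rdot w w.
  have [nm|mn] := leqP n m.
    by rewrite big_geq // mulr_ge0 ?rdot_ge0 // ltW.
  apply: le_trans (bK n w).
  rewrite /ell2_sqsum (big_cat_nat (leq0n m) (ltnW mn)) //= lerDr.
  by apply: sumr_ge0 => i _; exact: rdot_ge0.
have : rdot w w <= \sum_(m <= i < n)
    (K * rdot (u i) (u i) + K^-1 * rdot (star (b i) w) (star (b i) w)) / 2.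
  rewrite {1}/w rdot_suml; apply: ler_sum => i _.
  by rewrite rdot_star rdot_AMGM.
rewrite -mulr_suml big_split /= -!mulr_sumr => le.
have := ler_wpM2l (ltW V0) bw; rewrite mulrA mulVf ?gt_eqF // mul1r.
lra.
Qed.

Lemma ell2_mul_cvg (b a : nat -> A) (Kb Ka : R) : 0 < Kb -> 0 <= Ka ->
  (forall N h, ell2_sqsum b N h <= Kb * rdot h h) ->
  (forall N h, ell2_sqsum a N h <= Ka * rdot h h) ->
  exists L : A, strong_cvg (series (fun n => b n * star (a n))) L.
Proof.
move=> Kb0 Ka0 bK aK.
have K0 : 0 <= Kb * Ka by rewrite mulr_ge0 // ltW.
(* The natural bound is the square root of [Kb * Ka]; [1 + Kb * Ka] dominates it. *)
apply: (@vn_strong_complete _ _ _ _ (1 + Kb * Ka)); first by rewrite addr_ge0.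
  move=> N h; apply: nrm_le_sqr; first by rewrite mulr_ge0 ?nrm_ge0 ?addr_ge0.
  rewrite vn_sumE.
  apply: (le_trans (block_bound (fun i => star (a i) h) _ _ Kb0 bK)).
  apply: (le_trans (ler_wpM2l (ltW Kb0) (aK N h))).
  rewrite exprMn rdot_nrm mulrA ler_wpM2r ?sqr_ge0 //.
  by have := sqr_ge0 (Kb * Ka); lra.
move=> h; apply: hilbert_cauchy => e e0.
have d0 : 0 < e ^+ 2 / Kb by rewrite divr_gt0 ?exprn_gt0.
have [N NP] := sum_tail_lt (fun n => rdot_ge0 (star (a n) h)) (fun N => aK N h) d0.
exists N => m n Nm mn.
rewrite -(@ltr_pXn2r _ 2) ?nnegrE ?nrm_ge0 ?(ltW e0) // -rdot_nrm !vn_sumE.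
rewrite (big_cat_nat (leq0n m) mn) /= addrC addrK.
apply: (le_lt_trans (block_bound (fun i => star (a i) h) m n Kb0 bK)).
by rewrite mulrC -ltr_pdivlMr // NP.
Qed.

Lemma ell2_dotP (a b : ell2 A) :
  strong_cvg (series (fun n => (a n : A) * star (b n))) (ell2_dot a b).
Proof.
have [Ka Ka0 aK] := ell2_bounded a; have [Kb Kb0 bK] := ell2_bounded b.
have [L cL] := ell2_mul_cvg Ka0 (ltW Kb0) aK bK.
by rewrite /ell2_dot (strong_sumE cL).
Qed.

Lemma ell2_dot_weak (a b : ell2 A) :
  weak_cvg (series (fun n => (a n : A) * star (b n))) (ell2_dot a b).
Proof. by apply: strong_weak_cvg; exact: ell2_dotP. Qed.

Lemma ell2_dot_star (a b : ell2 A) : star (ell2_dot a b) = ell2_dot b a.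
Proof.
apply: (weak_cvg_unique _ (@ell2_dot_weak b a)).
apply: (weak_cvg_eq _ (weak_cvg_star (@ell2_dot_weak a b))) => N.
apply: vn_rdot_ext => h k; rewrite rdot_starl !vn_sumE rdotC !rdot_suml.
by apply: eq_bigr => n _; rewrite !vnME rdot_star [RHS]rdot_star rdotC.
Qed.

Lemma ell2_dot_linearl (c : A) (a b d : ell2 A) :
  ell2_dot (c *: a + b) d = c * ell2_dot a d + ell2_dot b d.
Proof.
apply: (weak_cvg_unique (@ell2_dot_weak _ _)).
apply: (weak_cvg_eq _ (weak_cvgD
  (@weak_cvgMl _ _ _ c _ _ (@ell2_dot_weak a d)) (@ell2_dot_weak b d))).
move=> N; apply: vn_rdot_ext => h k.
rewrite vnDE (vnME c) !vn_sumE rdotDl (rdot_star c) !rdot_suml -big_split.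
apply: eq_bigr => n _.
have E : (c *: a + b) n = c * a n + b n :> A by [].
by rewrite E mulrDl -mulrA vnDE rdotDl (vnME c) (rdot_star c).
Qed.

Lemma ell2_dot_linearr (c : A) (a b d : ell2 A) :
  ell2_dot d (c *: a + b) = ell2_dot d a * star c + ell2_dot d b.
Proof.
by rewrite -ell2_dot_star ell2_dot_linearl starED starEM !ell2_dot_star.
Qed.

Lemma ell2_dot_le (a : ell2 A) h (x : R) :
  (forall N, ell2_sqsum a N h <= x) -> rdot (ell2_dot a a h) h <= x.
Proof.
move=> ax; apply: (weak_cvg_le (@ell2_dot_weak a a)) => N.
by rewrite ell2_sqsum_series.
Qed.

Lemma ell2_sqsum_le_dot (a : ell2 A) N h :
  ell2_sqsum a N h <= rdot (ell2_dot a a h) h.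
Proof.
rewrite -ell2_sqsum_series.
apply: (@weak_cvg_nondecreasing _ _ _ _ _ h (@ell2_dot_weak a a)) => m n mn.
by rewrite !ell2_sqsum_series; exact: ell2_sqsum_le.
Qed.

Lemma ell2_dot_ge0 (a : ell2 A) h : 0 <= rdot (ell2_dot a a h) h.
Proof.
by apply: le_trans (ell2_sqsum_le_dot a 0 h); rewrite /ell2_sqsum big_geq.
Qed.

Lemma ell2_norm_sqr (a : ell2 A) : ell2_norm a ^+ 2 = opnorm (ell2_dot a a).
Proof.
rewrite /ell2_norm /inner_norm sqr_sqrtr //.
by have [] := opnormP (ell2_dot a a).
Qed.

Lemma ell2_norm_le (a : ell2 A) (K : R) : 0 <= K ->
  (ell2_norm a <= K <-> forall h, rdot (ell2_dot a a h) h <= K ^+ 2 * rdot h h).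
Proof.
move=> K0; have := opnorm_pos (ell2_dot_star a a) (ell2_dot_ge0 a) (sqr_ge0 K).
by rewrite -ell2_norm_sqr ler_pXn2r // ?nnegrE // sqrtr_ge0.
Qed.

Lemma ell2_dot_le_norm (a : ell2 A) h :
  rdot (ell2_dot a a h) h <= ell2_norm a ^+ 2 * rdot h h.
Proof.
have n0 : 0 <= ell2_norm a := sqrtr_ge0 _.
by apply: (ell2_norm_le a n0).1; exact: lexx.
Qed.

(** Written as a combination of the [ell2_e A n], so that the values of a module map there determine
    it on truncations. *)
Definition ell2_trunc (a : nat -> A) N : ell2 A :=
  \sum_(0 <= n < N) a n *: ell2_e A n.

Lemma ell2_truncE (a : nat -> A) N (k : nat) :
  ell2_trunc a N k = (if (k < N)%N then a k else 0) :> A.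
Proof.
have sumE (F : nat -> ell2 A) M :
    (\sum_(0 <= n < M) F n : ell2 A) k = \sum_(0 <= n < M) (F n k : A).
  elim: M => [|M IH]; first by rewrite !big_geq.
  by rewrite !big_nat_recr //= -IH.
rewrite /ell2_trunc sumE.
rewrite (eq_bigr (fun n => if n == k then a k else 0)); last first.
  move=> n _.
  have -> : (a n *: ell2_e A n) k = a n * (if k == n then 1 else 0) by [].
  by rewrite eq_sym; case: eqP => [->|]; rewrite ?mulr1 ?mulr0.
by rewrite -big_mkcond big_nat1_eq.
Qed.

Lemma ell2_dot_trunc (a : nat -> A) (b : ell2 A) N :
  ell2_dot (ell2_trunc a N) b = series (fun n => a n * star (b n)) N.
Proof.
apply: (weak_cvg_unique (@ell2_dot_weak _ _)) => h k.
apply: cvg_near_cst; exists N => // m /= Nm.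
rewrite !vn_sumE !rdot_suml (big_cat_nat (leq0n N) Nm) /=.
rewrite [X in _ + X]big1_seq ?addr0; last first.
  move=> n; rewrite mem_index_iota => /and3P[_ Nn _].
  have nN : (n < N)%N = false by rewrite ltnNge Nn.
  by rewrite ell2_truncE nN vn0E rdot0l.
by apply: eq_big_nat => n /andP[_ nN]; rewrite ell2_truncE nN.
Qed.

(** Here [N] depends on [h]: the norms of the tails need not tend to 0. *)
Lemma ell2_tail_cvg0 (a : ell2 A) h (e : R) : 0 < e -> exists N,
  forall m, (N <= m)%N ->
  rdot (ell2_dot (a - ell2_trunc a m) (a - ell2_trunc a m) h) h <= e.
Proof.
move=> e0; have [K K0 aK] := ell2_bounded a.
have [N NP] := sum_tail_lt (fun n => rdot_ge0 (star (a n) h)) (fun N => aK N h) e0.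
exists N => m Nm; apply: ell2_dot_le => M.
have tE n : (a - ell2_trunc a m) n = if (n < m)%N then 0 else a n.
  have -> : (a - ell2_trunc a m) n = a n - ell2_trunc a m n by [].
  by rewrite ell2_truncE; case: ifP; rewrite ?subrr ?subr0.
pose x n := rdot (star (a n) h) (star (a n) h).
have -> : ell2_sqsum (a - ell2_trunc a m) M h =
    \sum_(0 <= n < M) if (n < m)%N then 0 else x n.
  by apply: eq_bigr => n _; rewrite tE; case: ifP => // _; rewrite star0 rdot0l.
have [Mm|mM] := leqP M m.
  rewrite big1_seq ?ltW // => n; rewrite mem_index_iota => /andP[_ /andP[_ nM]].
  by rewrite (leq_trans nM Mm).
rewrite (big_cat_nat (leq0n m) (ltnW mM)) /= [X in X + _]big1_seq ?add0r.
  rewrite (@eq_big_nat _ _ _ m M _ x); first by rewrite ltW // NP // ltnW.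
  by move=> n /andP[Nn _]; rewrite ltnNge Nn.
by move=> n; rewrite mem_index_iota => /andP[_ /andP[_ ->]].
Qed.

End Ell2.

(** * Scalar forms, Cauchy-Schwarz inequalities and completeness in a Hilbert module *)

Section HilbertModule.
Context (R : realType) (H : hilbertType R) (A : vnalg H) (X : hilbertModType A).
Implicit Types (x y z : X) (c : A) (h k : H) (r t : R).

Lemma mdotDl x y z : mdot (x + y) z = mdot x z + mdot y z.
Proof. by rewrite -[x in x + _]scale1r mdot_linear mul1r. Qed.

Lemma mdot0l z : mdot 0 z = 0.
Proof. by apply: (addrI (mdot 0 z)); rewrite -mdotDl !addr0. Qed.

Lemma mdotZl c x z : mdot (c *: x) z = c * mdot x z.
Proof. by rewrite -[c *: x]addr0 mdot_linear mdot0l addr0. Qed.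

Lemma mdotDr x y z : mdot z (x + y) = mdot z x + mdot z y.
Proof. by rewrite -mdot_star mdotDl starED !mdot_star. Qed.

Lemma mdotZr c x z : mdot z (c *: x) = mdot z x * star c.
Proof. by rewrite -mdot_star mdotZl starEM !mdot_star. Qed.

Lemma mdotBl x y z : mdot (x - y) z = mdot x z - mdot y z.
Proof. by apply/eqP; rewrite eq_sym subr_eq -mdotDl subrK. Qed.

Lemma mdotBr x y z : mdot z (x - y) = mdot z x - mdot z y.
Proof. by apply/eqP; rewrite eq_sym subr_eq -mdotDr subrK. Qed.

Lemma mdot0r z : mdot z 0 = 0.
Proof. by apply: (addrI (mdot z 0)); rewrite -mdotDr !addr0. Qed.

Lemma mdot_sumr (I : Type) (s : seq I) (P : pred I) (F : I -> X) z :
  mdot z (\sum_(i <- s | P i) F i) = \sum_(i <- s | P i) mdot z (F i).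
Proof.
by apply: (big_morph (fun x => mdot z x) _ (mdot0r z)) => x y; exact: mdotDr.
Qed.

Lemma mdot_ext x y : (forall z, mdot z x = mdot z y) -> x = y.
Proof.
move=> xy; apply/eqP; rewrite -subr_eq0; apply/eqP/mdot_eq0.
by rewrite mdotBr xy subrr.
Qed.

Definition mphi x y h : R := rdot (mdot x y h) h.
Definition mform x h : R := mphi x x h.

Lemma mform_ge0 x h : 0 <= mform x h.
Proof.
have sx : star (mdot x x) = mdot x x by rewrite mdot_star.
have s0 : star (0 : A) = 0 by apply: vn_ext => k; rewrite star0.
by have /(op_leP s0 sx) /(_ h) := mdot_ge0 x; rewrite vn0E rdot0l.
Qed.

Lemma mphiC x y h : mphi x y h = mphi y x h.
Proof. by rewrite /mphi rdot_star mdot_star rdotC. Qed.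

(** Only [A] acts on the module, so real scalars enter as multiples of the unit. *)
Definition rscale r : A := r%:C *: (1 : A).

Lemma rscale_mul r c : rscale r * c = r%:C *: c.
Proof. by apply: vn_ext => h; rewrite vnME !vnZE vn_mul1E. Qed.

Lemma mul_rscale r c : c * rscale r = r%:C *: c.
Proof. by apply: vn_ext => h; rewrite vnME !vnZE vn_scaler vn_mulr1E. Qed.

Lemma star_rscale r : star (rscale r) = rscale r.
Proof. by rewrite starEZ star1. Qed.

Lemma mphi_scalel r x y h : mphi (rscale r *: x) y h = r * mphi x y h.
Proof. by rewrite /mphi mdotZl rscale_mul vnZE rdotZl. Qed.

Lemma mphi_scaler r x y h : mphi x (rscale r *: y) h = r * mphi x y h.
Proof. by rewrite mphiC mphi_scalel mphiC. Qed.

Lemma mphiDl x y z h : mphi (x + y) z h = mphi x z h + mphi y z h.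
Proof. by rewrite /mphi mdotDl vnDE rdotDl. Qed.

Lemma mphiBl x y z h : mphi (x - y) z h = mphi x z h - mphi y z h.
Proof. by rewrite /mphi mdotBl vnBE rdotBl. Qed.

Lemma mphiDr x y z h : mphi z (x + y) h = mphi z x h + mphi z y h.
Proof. by rewrite !(mphiC z) mphiDl. Qed.

Lemma mphiBr x y z h : mphi z (x - y) h = mphi z x h - mphi z y h.
Proof. by rewrite !(mphiC z) mphiBl. Qed.

Lemma mformZ c x h : mform (c *: x) h = mform x (star c h).
Proof. by rewrite /mform /mphi mdotZl mdotZr mulrA !vnME rdot_star. Qed.

Lemma mform_scale r x h : mform (rscale r *: x) h = r ^+ 2 * mform x h.
Proof. by rewrite /mform mphi_scalel mphi_scaler mulrA. Qed.

Lemma mform_sub x y h : mform (x - y) h = mform x h - 2 * mphi x y h + mform y h.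
Proof. by rewrite /mform mphiBl !mphiBr (mphiC y x); ring. Qed.

Lemma mphi_CS x y h : mphi x y h ^+ 2 <= mform x h * mform y h.
Proof.
rewrite mulrC; apply: discriminant_le; rewrite ?mform_ge0 // => t.
have := mform_ge0 (x - rscale t *: y) h.
by rewrite mform_sub mphi_scaler mform_scale; lra.
Qed.

(** Positivity of the form at [x - K^-1 <x, y> y], an approximate projection of [x] off [y] in which
    the bound [K] stands in for [<y, y>]. *)
Lemma mdot_CS (K : R) x y h : 0 < K -> (forall k, mform y k <= K * rdot k k) ->
  rdot (mdot y x h) (mdot y x h) <= K * mform x h.
Proof.
move=> K0 yK; have := mform_ge0 (x - rscale K^-1 *: (mdot x y *: y)) h.
rewrite mform_sub mphi_scaler mform_scale mformZ mdot_star.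
have -> : mphi x (mdot x y *: y) h = rdot (mdot y x h) (mdot y x h).
  by rewrite /mphi mdotZr vnME rdot_star mdot_star.
have := yK (mdot y x h); set m := rdot _ _; move: (mform y _) (mform x _) => p q pm.
have V0 : 0 < K^-1 by rewrite invr_gt0.
have V2 : 0 <= K^-1 ^+ 2 by rewrite sqr_ge0.
have := ler_wpM2l V2 pm.
have -> : K^-1 ^+ 2 * (K * m) = K^-1 * m by field; rewrite gt_eqF.
move=> le1 le2; rewrite -ler_pdivrMl //; lra.
Qed.

Lemma mnorm_ge0 x : 0 <= mnorm x.
Proof. exact: sqrtr_ge0. Qed.

Lemma mnorm_sqr x : mnorm x ^+ 2 = opnorm (mdot x x).
Proof.
by rewrite /mnorm /inner_norm sqr_sqrtr //; have [] := opnormP (mdot x x).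
Qed.

Lemma mnorm_le x (K : R) : 0 <= K ->
  (mnorm x <= K <-> forall h, mform x h <= K ^+ 2 * rdot h h).
Proof.
move=> K0; have := opnorm_pos (mdot_star x x) (mform_ge0 x) (sqr_ge0 K).
by rewrite -mnorm_sqr ler_pXn2r // ?nnegrE // mnorm_ge0.
Qed.

Lemma mform_le_mnorm x h : mform x h <= mnorm x ^+ 2 * rdot h h.
Proof. exact: (mnorm_le x (mnorm_ge0 x)).1. Qed.

Lemma mnorm_triangle x y : mnorm (x + y) <= mnorm x + mnorm y.
Proof.
set s := mnorm x; set t := mnorm y.
have s0 : 0 <= s := mnorm_ge0 x; have t0 : 0 <= t := mnorm_ge0 y.
apply/mnorm_le => [|h]; first by rewrite addr_ge0.
have px := mform_le_mnorm x h; have py := mform_le_mnorm y h.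
rewrite -/s -/t in px py.
have -> : mform (x + y) h = mform x h + 2 * mphi x y h + mform y h.
  by rewrite /mform mphiDl !mphiDr (mphiC y x); ring.
suff : mphi x y h <= s * t * rdot h h by move=> ?; lra.
have st0 : 0 <= s * t * rdot h h by rewrite !mulr_ge0 // rdot_ge0.
have [n0|p0] := leP (mphi x y h) 0; first exact: le_trans n0 st0.
rewrite -(@ler_pXn2r _ 2) // ?nnegrE ?(ltW p0) //.
apply: (le_trans (mphi_CS x y h)).
apply: (@le_trans _ _ (s ^+ 2 * rdot h h * (t ^+ 2 * rdot h h))).
  by apply: ler_pM; rewrite ?mform_ge0.
by rewrite le_eqVlt; apply/orP; left; apply/eqP; ring.
Qed.

Lemma mnormB x y : mnorm (x - y) = mnorm (y - x).
Proof.
rewrite /mnorm /inner_norm -(opprB x y); move: (x - y) => z.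
by rewrite -[- z]sub0r mdotBl mdot0l mdotBr mdot0r !sub0r opprK.
Qed.

Lemma mnorm_scale_le r x : 0 <= r -> mnorm (rscale r *: x) <= r * mnorm x.
Proof.
move=> r0; apply/mnorm_le => [|h]; first by rewrite mulr_ge0 // mnorm_ge0.
rewrite mform_scale; apply: (le_trans (ler_wpM2l (sqr_ge0 r) (mform_le_mnorm x h))).
by rewrite exprMn mulrA.
Qed.

Lemma mnorm0 : mnorm (0 : X) = 0.
Proof.
apply/eqP; rewrite eq_le mnorm_ge0 andbT; apply/mnorm_le => // h.
by rewrite /mform /mphi mdot0l vn0E rdot0l expr0n mul0r.
Qed.

(** The form in which completeness serves both the Neumann series and the gliding hump; the explicit
    tail bound is essential to the latter. *)
Lemma geometric_sum_limit (u : nat -> X) (K r : R) : 0 <= K -> 0 <= r < 1 ->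
  (forall n, mnorm (u n) <= K * r ^+ n) ->
  exists l : X, forall N,
    mnorm (l - \sum_(0 <= n < N) u n) <= K * r ^+ N / (1 - r).
Proof.
move=> K0 /andP[r0 r1] uK.
have d0 : 0 < 1 - r by rewrite subr_gt0.
pose s N := \sum_(0 <= n < N) u n.
have sB m p : mnorm (s (m + p)%N - s m) <= K * r ^+ m / (1 - r) * (1 - r ^+ p).
  elim: p => [|p IH]; first by rewrite addn0 subrr mnorm0 expr0 subrr mulr0.
  rewrite /s addnS big_nat_recr //= -/(s _) addrAC.
  apply: (le_trans (mnorm_triangle _ _)).
  apply: (le_trans (lerD IH (uK _))); rewrite exprD exprS.
  rewrite le_eqVlt; apply/orP; left; apply/eqP; field.
  by rewrite gt_eqF.
have sC m n : (m <= n)%N -> mnorm (s n - s m) <= K * r ^+ m / (1 - r).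
  move=> mn; rewrite -(subnKC mn); apply: (le_trans (sB _ _)).
  rewrite ler_piMr ?divr_ge0 ?mulr_ge0 ?exprn_ge0 ?(ltW d0) //.
  by rewrite lerBlDr lerDl exprn_ge0.
have small (e : R) : 0 < e -> exists N, forall m, (N <= m)%N ->
    K * r ^+ m / (1 - r) < e.
  move=> e0.
  have : (K / (1 - r)) * r ^+ n @[n --> \oo] --> (K / (1 - r)) * 0.
    by apply: cvgMr; apply: cvg_expr; rewrite ger0_norm.
  rewrite mulr0 => /cvgrPdist_lt /(_ e e0) [N _ NP]; exists N => m /NP /=.
  rewrite sub0r normrN mulrAC; apply: le_lt_trans; exact: ler_norm.
have [l sl] : exists l : X, mnorm (s n - l) @[n --> \oo] --> (0 : R).
  apply: mdot_complete => e e0; have [N NP] := small e e0; exists N => m n Nm Nn.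
  have [mn|nm] := leqP m n.
    rewrite -/(mnorm _) mnormB; apply: le_lt_trans (sC _ _ mn) _; exact: NP.
  by apply: le_lt_trans (sC _ _ (ltnW nm)) _; exact: NP.
exists l => N; apply/ler_addgt0Pr => e e0.
have /cvgrPdist_lt /(_ e e0) [M _ MP] := sl.
have /= := MP (maxn M N) (leq_maxl _ _).
rewrite sub0r normrN ger0_norm ?mnorm_ge0 // => lt.
have -> : l - \sum_(0 <= n < N) u n = (s (maxn M N) - s N) + (l - s (maxn M N)).
  by rewrite [RHS]addrC addrA subrK.
apply: (le_trans (mnorm_triangle _ _)); apply: lerD; first exact: sC (leq_maxr _ _).
by rewrite mnormB ltW.
Qed.

End HilbertModule.

(** * Cauchy-Schwarz and coordinates for the inner product of sequences *)

Section Ell2CauchySchwarz.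
Context (R : realType) (H : hilbertType R) (A : vnalg H).
Implicit Types (a b : ell2 A) (h k : H).

Lemma cvg_nrm_le (u : nat -> H) l (c : R) : u n @[n --> \oo] --> l ->
  (forall n, nrm (u n) <= c) -> nrm l <= c.
Proof.
move=> /cvg_nrm ul uc; apply/ler_addgt0Pr => e e0.
have [N NP] := ul e e0; have := NP N (leqnn N).
have := nrm_triangle (u N) (l - u N); rewrite addrC subrK nrmB.
by have := uc N; lra.
Qed.

Lemma ell2_dot_CS a b h (Ka Kb : R) : 0 <= Ka -> 0 <= Kb ->
  (forall N h, ell2_sqsum a N h <= Ka ^+ 2 * rdot h h) ->
  (forall N h, ell2_sqsum b N h <= Kb ^+ 2 * rdot h h) ->
  nrm (ell2_dot a b h) <= Ka * Kb * nrm h.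
Proof.
(* [block_bound] asks for a positive constant and [Ka] may vanish, hence [Ka + e]. *)
move=> Ka0 Kb0 aK bK; apply: (@le_of_linear_error _ _ _ (Kb * nrm h)) => e e0.
have Ke0 : 0 < Ka + e by rewrite ltr_wpDl.
have aKe N k : ell2_sqsum a N k <= (Ka + e) ^+ 2 * rdot k k.
  apply: (le_trans (aK N k)); rewrite ler_wpM2r ?rdot_ge0 //.
  by rewrite lerXn2r ?nnegrE ?(ltW Ke0) // lerDl ltW.
apply: (cvg_nrm_le (@ell2_dotP _ _ _ a b h)) => N.
have -> : Ka * Kb * nrm h + e * (Kb * nrm h) = (Ka + e) * (Kb * nrm h) by ring.
apply: nrm_le_sqr; first by rewrite !mulr_ge0 ?nrm_ge0 ?(ltW Ke0).
rewrite vn_sumE.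
apply: (le_trans (block_bound (fun i => star (b i) h) 0 N (exprn_gt0 2 Ke0) aKe)).
rewrite exprMn ler_wpM2l ?sqr_ge0 //; apply: (le_trans (bK N h)).
by rewrite exprMn rdot_nrm.
Qed.

Lemma ell2_dot_AMGM a b h (s : R) : 0 < s ->
  rdot (ell2_dot a b h) h <=
  (s * rdot (ell2_dot b b h) h + s^-1 * rdot (ell2_dot a a h) h) / 2.
Proof.
move=> s0; apply: (weak_cvg_le (@ell2_dot_weak _ _ _ a b)) => N.
apply: (@le_trans _ _ ((s * ell2_sqsum b N h + s^-1 * ell2_sqsum a N h) / 2)).
  rewrite vn_sumE rdot_suml /ell2_sqsum !mulr_sumr -big_split mulr_suml.
  by apply: ler_sum => n _; rewrite vnME rdot_star rdot_AMGM.
have V0 : 0 <= s^-1 by rewrite invr_ge0 ltW.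
have := ler_wpM2l V0 (ell2_sqsum_le_dot a N h).
have := ler_wpM2l (ltW s0) (ell2_sqsum_le_dot b N h).
lra.
Qed.

Lemma ell2_dot_e a (n : nat) : ell2_dot a (ell2_e A n) = a n.
Proof.
apply: (weak_cvg_unique (@ell2_dot_weak _ _ _ _ _)) => h k.
apply: cvg_near_cst; exists n.+1 => // m nm.
rewrite vn_sumE rdot_suml.
rewrite (eq_bigr (fun i => if i == n then rdot (a n h) k else 0)); last first.
  move=> i _; have -> : ell2_e A n i = (if i == n then 1 else 0) :> A by [].
  case: eqP => [->|_]; first by rewrite star1 mulr1.
  by rewrite vnME star0 -[X in a i X](scale0r h) vn_scaler scale0r rdot0l.
by rewrite -big_mkcond big_nat1_eq /= nm.
Qed.

Lemma ell2_dotZ (c : A) a h :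
  rdot (ell2_dot (c *: a) (c *: a) h) h = rdot (ell2_dot a a (star c h)) (star c h).
Proof.
have d0 b : ell2_dot 0 b = 0.
  by rewrite -(addNr b) -[- b]scaleN1r ell2_dot_linearl mulN1r addNr.
rewrite -[c *: a]addr0 ell2_dot_linearl d0 !addr0.
rewrite -[c *: a]addr0 ell2_dot_linearr -[ell2_dot a 0]ell2_dot_star d0.
have -> : star (0 : A) = 0 by apply: vn_ext => k; rewrite star0.
by rewrite addr0 !vnME rdot_star.
Qed.

End Ell2CauchySchwarz.

(** * Weak frames expressed through partial sums *)

Section WeakFrame.
Context (R : realType) (H : hilbertType R) (A : vnalg H) (X : hilbertModType A).
Implicit Types (x : nat -> X) (y : X) (h : H).

(** The frame inequalities with the limit replaced by the supremum of the partial sums: the second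
    clause puts [C <y, y>] below each of their upper bounds. *)
Definition frame_bounds x (C D : R) := forall y h,
  (forall N, ell2_sqsum (fun n => mdot y (x n)) N h <= D * mform y h) /\
  (forall B, (forall N, ell2_sqsum (fun n => mdot y (x n)) N h <= B) ->
    C * mform y h <= B).

(** Conversely, the upper bound makes the coefficients square-summable, so the series converges
    strongly by [ell2_mul_cvg]; monotonicity makes its limit the supremum. *)
Lemma weak_frameP x :
  weak_frame x <-> exists C D : R, [/\ 0 < C, 0 < D & frame_bounds x C D].
Proof.
have sZ (r : R) y : star (r%:C *: mdot y y : A) = r%:C *: mdot y y.
  by rewrite starEZ mdot_star.
have sS y (S : A) :
    strong_cvg (series (fun n => mdot y (x n) * star (mdot y (x n)))) S ->
    star S = S.
  move=> /strong_weak_cvg yS; apply: (weak_cvg_unique (weak_cvg_star yS)).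
  apply: (weak_cvg_eq _ yS) => N; apply: vn_rdot_ext => h k.
  rewrite rdot_starl !vn_sumE [RHS]rdotC !rdot_suml; apply: eq_bigr => n _.
  by rewrite !vnME rdot_star [RHS]rdot_star rdotC.
split=> -[C [D [C0 D0 CD]]]; exists C, D; split => //.
  move=> y h; have [S [yS CS SD]] := CD y.
  have sSy := sS _ _ yS.
  have {}CS := (op_leP (sZ C y) sSy).1 CS h.
  have {}SD := (op_leP sSy (sZ D y)).1 SD h.
  rewrite vnZE rdotZl in CS; rewrite vnZE rdotZl in SD.
  have yw := strong_weak_cvg yS; split.
    move=> N; apply: le_trans SD; rewrite -ell2_sqsum_series.
    apply: (weak_cvg_nondecreasing yw) => m n mn.
    by rewrite !ell2_sqsum_series; exact: ell2_sqsum_le.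
  move=> B NB; apply: (le_trans CS); apply: (weak_cvg_le yw) => N.
  by rewrite ell2_sqsum_series.
move=> y; have K0 : 0 < D * (mnorm y ^+ 2 + 1).
  by rewrite mulr_gt0 // ltr_wpDl ?sqr_ge0.
have yK N h : ell2_sqsum (fun n => mdot y (x n)) N h <=
    D * (mnorm y ^+ 2 + 1) * rdot h h.
  apply: (le_trans ((CD y h).1 N)); rewrite -mulrA ler_wpM2l ?(ltW D0) //.
  apply: (le_trans (mform_le_mnorm y h)).
  by rewrite ler_wpM2r ?rdot_ge0 // lerDl.
have [S yS] := ell2_mul_cvg K0 (ltW K0) yK yK.
have yw := strong_weak_cvg yS; have sSy := sS _ _ yS.
exists S; split => //.
  apply/(op_leP (sZ C y) sSy) => h; rewrite vnZE rdotZl.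
  apply: (CD y h).2 => N; rewrite -ell2_sqsum_series.
  apply: (weak_cvg_nondecreasing yw) => m n mn.
  by rewrite !ell2_sqsum_series; exact: ell2_sqsum_le.
apply/(op_leP sSy (sZ D y)) => h; rewrite vnZE rdotZl.
apply: (weak_cvg_le yw) => N; rewrite ell2_sqsum_series; exact: (CD y h).1.
Qed.

Lemma mnorm_eq0 y : mnorm y <= 0 -> y = 0.
Proof.
move=> y0; apply: mdot_eq0; apply: vn_ext => h.
have n0 : mnorm y = 0 by apply/eqP; rewrite eq_le y0 mnorm_ge0.
have := nrm_bop (mdot y y) h; rewrite -mnorm_sqr n0 expr0n mul0r => le.
apply/eqP; rewrite vn0E -normr_eq0 nrmE.
by have -> : nrm (mdot y y h) = 0 by apply/eqP; rewrite eq_le le nrm_ge0.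
Qed.

End WeakFrame.

(** * The analysis map, built from the upper bound so as to serve both implications *)

Section Analysis.
Context (R : realType) (H : hilbertType R) (A : vnalg H) (X : hilbertModType A).
Context (x : nat -> X) (D : R) (D0 : 0 < D).
Context (xD : forall (y : X) (h : H) N,
  ell2_sqsum (fun n => mdot y (x n)) N h <= D * mform y h).
Implicit Types (y z : X) (h : H).

Lemma analysis_bound y N h :
  ell2_sqsum (fun n => mdot y (x n)) N h <= (Num.sqrt D * mnorm y) ^+ 2 * rdot h h.
Proof.
apply: (le_trans (xD y h N)); rewrite exprMn sqr_sqrtr ?(ltW D0) //.
by rewrite -mulrA ler_wpM2l ?(ltW D0) // mform_le_mnorm.
Qed.

Definition analysis y : ell2 A := Ell2 (ell2_of_bounded (analysis_bound y)).

Lemma analysis_linear (c : A) y z :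
  analysis (c *: y + z) = c *: analysis y + analysis z.
Proof.
apply: val_inj; apply/funext => n.
have -> : val (c *: analysis y + analysis z) n =
  c * mdot y (x n) + mdot z (x n) by [].
by rewrite /= mdot_linear.
Qed.

Lemma analysis_upper y h :
  rdot (ell2_dot (analysis y) (analysis y) h) h <= D * mform y h.
Proof. by apply: ell2_dot_le => N; exact: xD. Qed.

End Analysis.

(** * From a weak frame to a bounded surjection *)

Section Synthesis.
Context (R : realType) (H : hilbertType R) (A : vnalg H) (X : hilbertModType A).
Context (X_self_dual : self_dual X) (x : nat -> X) (C D : R).
Context (C0 : 0 < C) (D0 : 0 < D) (xCD : frame_bounds x C D).
Implicit Types (y z : X) (a b : ell2 A) (h k : H).

Let xD y h : forall N, ell2_sqsum (fun n => mdot y (x n)) N h <= D * mform y h :=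
  (xCD y h).1.
Local Notation analysis := (analysis D0 xD).

Lemma analysis_lower y h :
  C * mform y h <= rdot (ell2_dot (analysis y) (analysis y) h) h.
Proof.
apply: (xCD y h).2 => N; exact: (ell2_sqsum_le_dot (analysis y) N h).
Qed.

Definition analysis_functional a y : A^o := ell2_dot (analysis y) a.

Lemma analysis_functional_linear a : linear (analysis_functional a).
Proof.
by move=> c y z; rewrite /analysis_functional analysis_linear ell2_dot_linearl.
Qed.

HB.instance Definition _ a := GRing.isLinear.Build (vn_type A) X A^o _
  (analysis_functional a) (analysis_functional_linear a).

(* The adjoint of the analysis map, which exists because X is self-dual. *)
Lemma synthesis_ex a : exists z : X, forall y, mdot y z = ell2_dot (analysis y) a.
Proof.
have [z zP] : exists z : X, forall y, analysis_functional a y = mdot y z.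
  apply: (X_self_dual (f := analysis_functional a)).
  have [K K0 aK] := ell2_bounded a.
  exists (Num.sqrt D * Num.sqrt K) => y.
  apply: opnorm_le; first by rewrite !mulr_ge0 ?sqrtr_ge0 ?mnorm_ge0.
  apply/bounded_byE => h.
  apply: (le_trans (@ell2_dot_CS _ _ _ (analysis y) a h (Num.sqrt D * mnorm y)
    (Num.sqrt K) _ _ _ _)).
  - by rewrite mulr_ge0 ?sqrtr_ge0 ?mnorm_ge0.
  - exact: sqrtr_ge0.
  - by move=> N k; exact: (analysis_bound D0 xD).
  - by move=> N k; rewrite sqr_sqrtr ?(ltW K0).
  - by rewrite (mulrAC (Num.sqrt D)).
by exists z => y; rewrite -zP.
Qed.

Definition synthesis a : X := projT1 (cid (synthesis_ex a)).

Lemma synthesisP a y : mdot y (synthesis a) = ell2_dot (analysis y) a.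
Proof. by rewrite /synthesis; case: cid. Qed.

Lemma synthesis_linear : linear synthesis.
Proof.
move=> c a b; apply: mdot_ext => y.
by rewrite synthesisP mdotDr mdotZr !synthesisP ell2_dot_linearr.
Qed.

HB.instance Definition _ := GRing.isLinear.Build (vn_type A) (ell2 A) X _
  synthesis synthesis_linear.

Lemma synthesis_e n : synthesis (ell2_e A n) = x n.
Proof. by apply: mdot_ext => y; rewrite synthesisP ell2_dot_e. Qed.

(** With [z = synthesis a], [<z, z>] is the product of [analysis z] and [a]. Weight [D] in the mean
    inequality turns the analysis part into at most [<z, z> / 2], which is absorbed. *)
Lemma synthesis_mform a h : mform (synthesis a) h <= D * rdot (ell2_dot a a h) h.
Proof.
have : mform (synthesis a) h = rdot (ell2_dot (analysis (synthesis a)) a h) h.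
  by rewrite -synthesisP.
move=> E; have := ell2_dot_AMGM (analysis (synthesis a)) a h D0; rewrite -E.
have V0 : 0 <= D^-1 by rewrite invr_ge0 ltW.
have := ler_wpM2l V0 (analysis_upper D0 xD (synthesis a) h).
rewrite mulrA mulVf ?gt_eqF // mul1r; lra.
Qed.

Lemma synthesis_bounded : bounded_map (@ell2_norm R H A) (@mnorm R H A X) synthesis.
Proof.
exists (Num.sqrt D) => a; have n0 : 0 <= ell2_norm a := sqrtr_ge0 _.
apply/mnorm_le => [|h]; first by rewrite mulr_ge0 ?sqrtr_ge0.
apply: (le_trans (synthesis_mform a h)).
rewrite exprMn sqr_sqrtr ?(ltW D0) // -mulrA ler_wpM2l ?(ltW D0) //.
exact: ell2_dot_le_norm.
Qed.

(* With F = synthesis \o analysis and w = 1 / (C + D), the map G = 1 - w F is a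
   contraction, so the Neumann series w (1 + G + G^2 + ...) inverts F. *)
Lemma synthesis_surjective y : exists a, synthesis a = y.
Proof.
pose F z := synthesis (analysis z).
have FB z z' : F (z - z') = F z - F z'.
  have -> : z - z' = (-1) *: z' + z by rewrite scaleN1r addrC.
  by rewrite /F analysis_linear synthesis_linear scaleN1r addrC.
have CD0 : 0 < C + D by rewrite addr_gt0.
pose w := (C + D)^-1; have w0 : 0 < w by rewrite invr_gt0.
have wCD : w * C + w * D = 1 by rewrite -mulrDr mulVf // gt_eqF.
pose G z := z - rscale A w *: F z.
pose s := 1 - w * C.
have s0 : 0 <= s by rewrite /s -wCD addrAC subrr add0r mulr_ge0 // ltW.
have s1 : s < 1 by rewrite /s ltrBlDr ltrDl mulr_gt0.
have qE z h : mphi z (F z) h = rdot (ell2_dot (analysis z) (analysis z) h) h.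
  by rewrite /mphi synthesisP.
have F2 z h : mform (F z) h <= D * mphi z (F z) h.
  by rewrite qE; exact: synthesis_mform.
(* For [p = <z, z>] and [q = <z, F z>] the form is at most [p - 2 w q + w^2 D q]. Since
   [w D = 1 - w C], this is at most [p - w q], and [C p <= q] leaves [(1 - w C) p]. *)
have Gs z h : mform (G z) h <= s * mform z h.
  rewrite /G mform_sub mform_scale mphi_scaler.
  have := mform_ge0 z h; have := analysis_lower z h; have := F2 z h; rewrite -qE.
  move: (mphi _ _ _) (mform z h) (mform (F z) h) => q p f fq pq p0.
  have q0 : 0 <= q by apply: le_trans pq; rewrite mulr_ge0 // ltW.
  have le1 := ler_wpM2l (sqr_ge0 w) fq; have le2 := ler_wpM2l (ltW w0) pq.
  have q1 : 0 <= w * (w * C) * q by rewrite !mulr_ge0 // ltW.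
  have E : w ^+ 2 * (D * q) = w * (w * C + w * D) * q - w * (w * C) * q by ring.
  by rewrite E wCD in le1; rewrite /s; lra.
pose r := Num.sqrt s; have r0 : 0 <= r by exact: sqrtr_ge0.
have rs : r ^+ 2 = s by rewrite sqr_sqrtr.
have r1 : r < 1 by rewrite -(@ltr_pXn2r _ 2) ?nnegrE // rs expr1n.
have Gr z : mnorm (G z) <= r * mnorm z.
  apply/mnorm_le => [|h]; first by rewrite mulr_ge0 ?mnorm_ge0.
  rewrite exprMn rs -mulrA; apply: (le_trans (Gs z h)).
  by rewrite ler_wpM2l // mform_le_mnorm.
have Gn n : mnorm (iter n G y) <= r ^+ n * mnorm y.
  elim: n => [|n IH]; first by rewrite mul1r.
  by rewrite iterS exprS -mulrA; apply: (le_trans (Gr _)); rewrite ler_wpM2l.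
have FD z : mnorm (F z) <= D * mnorm z.
  apply/mnorm_le => [|h]; first by rewrite mulr_ge0 ?mnorm_ge0 // ltW.
  apply: (le_trans (F2 z h)); rewrite expr2 -!mulrA ler_wpM2l ?(ltW D0) //.
  rewrite qE; apply: (le_trans (analysis_upper D0 xD z h)).
  rewrite mulrCA ler_wpM2l ?(ltW D0) //.
  by apply: (le_trans (mform_le_mnorm z h)); rewrite expr2 -mulrA.
pose u n := rscale A w *: iter n G y.
have r01 : 0 <= r < 1 by rewrite r0 r1.
have wy0 : 0 <= w * mnorm y by rewrite mulr_ge0 ?mnorm_ge0 // ltW.
have [|l lP] := geometric_sum_limit (u := u) wy0 r01.
  move=> n; apply: (le_trans (mnorm_scale_le _ (ltW w0))).
  by rewrite -mulrA ler_wpM2l ?(ltW w0) // mulrC.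
have F0 : F 0 = 0 by rewrite -{1}(subrr y) FB subrr.
have FZ z : F (rscale A w *: z) = z - G z.
  rewrite /G opprB addrC subrK -[_ *: z]addr0 {1}/F analysis_linear synthesis_linear.
  by rewrite -/(F z) -/(F 0) F0 addr0.
(* Telescoping, because [w F = 1 - G]. *)
have Fs N : F (\sum_(0 <= n < N) u n) = y - iter N G y.
  elim: N => [|N IH]; first by rewrite big_geq //= subrr F0.
  rewrite big_nat_recr //= -[u N]opprK FB -[- u N]sub0r FB.
  by rewrite IH FZ F0 sub0r opprK addrA subrK.
exists (analysis l); apply/eqP; rewrite -subr_eq0; apply/eqP/mnorm_eq0.
rewrite -/(F l).
apply: (@le_of_geometric_error _ _ _
  (D * (w * mnorm y / (1 - r)) + mnorm y) r r01) => n.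
have -> : F l - y = F (l - \sum_(0 <= i < n.+1) u i) - iter n.+1 G y.
  by rewrite FB Fs opprB addrA addrAC addrK.
apply: (le_trans (mnorm_triangle _ _)); rewrite add0r mulrDr.
apply: lerD; last by rewrite -sub0r mnormB subr0.
apply: (le_trans (FD _)); rewrite [leRHS]mulrCA ler_wpM2l ?(ltW D0) //.
by apply: (le_trans (lP _)); rewrite mulrA (mulrC (r ^+ _)).
Qed.

End Synthesis.

(** * From a bounded surjection to a weak frame *)

Section BoundedSurjection.
Context (R : realType) (H : hilbertType R) (A : vnalg H) (X : hilbertModType A).
Context (T : {linear ell2 A -> X}) (M : R).
Context (M0 : 0 < M) (TM : forall a, mnorm (T a) <= M * ell2_norm a).
Implicit Types (y z : X) (a b : ell2 A) (h k : H).

(** Since [T (b *: a) = b *: T a], the norm bound at [b *: a] is a statement about the conjugates of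
    [<a, a>] and [<T a, T a>] by [b]. *)
Lemma bounded_mform a h : mform (T a) h <= M ^+ 2 * rdot (ell2_dot a a h) h.
Proof.
apply: (op_le_of_conjugates (sqr_ge0 M) (ell2_dot_star a a) (ell2_dot_ge0 a)
  (mdot_star _ _) (mform_ge0 _)) => b K K0 aK {}h.
have bK k : rdot (ell2_dot (b *: a) (b *: a) k) k <= Num.sqrt K ^+ 2 * rdot k k.
  by rewrite ell2_dotZ sqr_sqrtr.
have bn := (ell2_norm_le (b *: a) (sqrtr_ge0 K)).2 bK.
have Tb : mnorm (T (b *: a)) <= M * Num.sqrt K.
  by apply: (le_trans (TM _)); rewrite ler_wpM2l // ltW.
have MK0 : 0 <= M * Num.sqrt K by rewrite mulr_ge0 ?sqrtr_ge0 // ltW.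
have := (mnorm_le _ MK0).1 Tb h.
by rewrite exprMn sqr_sqrtr // linearZ_LR mformZ.
Qed.

Lemma mdot_trunc y (a : nat -> A) N :
  mdot y (T (ell2_trunc a N)) =
  series (fun n => mdot y (T (ell2_e A n)) * star (a n)) N.
Proof.
rewrite /ell2_trunc linear_sum mdot_sumr /series; apply: eq_bigr => n _.
by rewrite linearZ_LR mdotZr.
Qed.

(** Test [y] against [T] of its own truncated coefficients: the sum [s] is [<y, T a>] at [h], so
    [s^2 <= <y, y> <T a, T a> <= M^2 <y, y> s], and [s] cancels. *)
Lemma bounded_sqsum y h N :
  ell2_sqsum (fun n => mdot y (T (ell2_e A n))) N h <= M ^+ 2 * mform y h.
Proof.
set a := (fun n => _); set s := ell2_sqsum a N h.
have sE : s = mphi y (T (ell2_trunc a N)) h.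
  by rewrite /mphi mdot_trunc ell2_sqsum_series.
have s2 : s = rdot (ell2_dot (ell2_trunc a N) (ell2_trunc a N) h) h.
  rewrite ell2_dot_trunc vn_sumE rdot_suml; apply: eq_big_nat => n /andP[_ nN].
  by rewrite ell2_truncE nN rdot_mulstar.
have s0 : 0 <= s by rewrite s2 ell2_dot_ge0.
have [->|sn0] := eqVneq s 0; first by rewrite mulr_ge0 ?sqr_ge0 ?mform_ge0.
have sp : 0 < s by rewrite lt_def sn0.
rewrite -(ler_pM2l sp) -expr2 {1}sE; apply: (le_trans (mphi_CS _ _ _)).
rewrite mulrC mulrA (mulrC s); apply: ler_wpM2r; first exact: mform_ge0.
by rewrite s2; exact: bounded_mform.
Qed.

Let M20 : 0 < M ^+ 2 := exprn_gt0 2 M0.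
Local Notation analysis := (analysis M20 bounded_sqsum).

(** For finite truncations this is linearity. The passage to [a] combines [mdot_CS] with
    [bounded_mform], which bound the error at [h] by the form of the tail at the same [h]. *)
Lemma mdot_analysis y a : mdot y (T a) = ell2_dot (analysis y) a.
Proof.
apply: (weak_cvg_unique _ (@ell2_dot_weak _ _ _ (analysis y) a)).
apply: strong_weak_cvg => h; apply/cvg_nrm => e e0.
pose K := mnorm y ^+ 2 + 1; have K0 : 0 < K by rewrite ltr_wpDl ?sqr_ge0.
have yK k : mform y k <= K * rdot k k.
  apply: (le_trans (mform_le_mnorm y k)).
  by rewrite ler_wpM2r ?rdot_ge0 // lerDl.
have d0 : 0 < e ^+ 2 / (K * M ^+ 2) / 2.
  by rewrite !divr_gt0 ?exprn_gt0 ?mulr_gt0 ?exprn_gt0.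
have [N NP] := ell2_tail_cvg0 a h d0; exists N => n Nn.
rewrite -[series _ n]mdot_trunc nrmB -vnBE -mdotBr -linearB.
rewrite -(@ltr_pXn2r _ 2) ?nnegrE ?nrm_ge0 ?(ltW e0) // -rdot_nrm.
apply: (le_lt_trans (mdot_CS _ _ K0 yK)).
apply: (le_lt_trans (ler_wpM2l (ltW K0) (bounded_mform _ h))).
rewrite mulrA; apply: (le_lt_trans (ler_wpM2l (ltW (mulr_gt0 K0 M20)) (NP n Nn))).
have -> : K * M ^+ 2 * (e ^+ 2 / (K * M ^+ 2) / 2) = e ^+ 2 / 2.
  by field; rewrite !gt_eqF.
by have := exprn_gt0 2 e0; lra.
Qed.

Lemma mdot_nrm_le y z h : 0 < mnorm y ->
  nrm (mdot y z h) <= mnorm y * mnorm z * nrm h.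
Proof.
move=> y0; apply: nrm_le_sqr; first by rewrite !mulr_ge0 ?mnorm_ge0 ?nrm_ge0.
apply: (le_trans (mdot_CS _ _ (exprn_gt0 2 y0) (mform_le_mnorm y))).
rewrite !exprMn -rdot_nrm -mulrA ler_wpM2l ?sqr_ge0 //; exact: mform_le_mnorm.
Qed.

(** For [u = r y], the products of [y] with [z + u] and [z - u] differ by [2 r <y, y>], so one of
    the two has norm at least [r |y|^2]. *)
Lemma hump y z (r : R) : 0 < r -> exists u : X,
  mnorm u <= r * mnorm y /\ r * mnorm y ^+ 2 <= opnorm (mdot y (z + u)).
Proof.
move=> r0; pose u := rscale A r *: y.
have un : mnorm u <= r * mnorm y by apply: mnorm_scale_le; exact: ltW.
set p := opnorm (mdot y (z + u)); set q := opnorm (mdot y (z - u)).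
have p0 : 0 <= p by have [] := opnormP (mdot y (z + u)).
have q0 : 0 <= q by have [] := opnormP (mdot y (z - u)).
suff pq : r * mnorm y ^+ 2 * 2 <= p + q.
  have [yp|py] := leP (r * mnorm y ^+ 2) p; first by exists u.
  exists (- u); split; first by rewrite -sub0r mnormB subr0.
  by rewrite -/q; lra.
rewrite mnorm_sqr mulrAC -ler_pdivlMl ?mulr_gt0 //.
apply: opnorm_le; first by rewrite mulr_ge0 ?invr_ge0 ?addr_ge0 ?mulr_ge0 // ltW.
apply/bounded_byE => h; rewrite -mulrA ler_pdivlMl ?mulr_gt0 //.
rewrite -[leLHS]nrmZ ?mulr_ge0 ?(ltW r0) //.
have -> : (r * 2)%:C *: mdot y y h = mdot y (z + u) h - mdot y (z - u) h.
  rewrite mdotDr mdotBr /u mdotZr star_rscale mul_rscale !vnDE.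
  have -> : (- (r%:C *: mdot y y : A)) h = - (r%:C *: mdot y y h) by [].
  rewrite vnZE opprD opprK addrACA subrr add0r -scalerDl -rmorphD /=.
  by rewrite mulr_natr mulr2n.
apply: (le_trans (nrm_triangle _ _)).
rewrite mulrDl; apply: lerD; first exact: nrm_bop.
by rewrite -[- _]sub0r nrmB subr0; exact: nrm_bop.
Qed.

(* Sokal's elementary proof of the uniform boundedness principle, applied to
   the functionals z |-> mdot y z. *)
Lemma analysis_bounded_below : (forall z, exists a, T a = z) ->
  exists K : R, forall y, mnorm y <= K * ell2_norm (analysis y).
Proof.
move=> Tsurj; apply: contrapT => nK.
(* The rate 4 must beat the rate 3 at which the humps shrink: the contradiction is
   [1 / 2 <= (3 / 4)^n Ka] for all positive [n]. *)
have badK (n : nat) : exists y, 4 ^+ n * ell2_norm (analysis y) < mnorm y.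
  apply: contrapT => nb; apply: nK; exists (4 ^+ n) => y.
  by rewrite leNgt; apply/negP => lt; apply: nb; exists y.
pose y n := projT1 (cid (badK n)).
have yP n : 4 ^+ n * ell2_norm (analysis (y n)) < mnorm (y n).
  by rewrite /y; case: cid.
have y0 n : 0 < mnorm (y n).
  by apply: le_lt_trans (yP n); rewrite mulr_ge0 ?exprn_ge0 ?sqrtr_ge0.
(* Scaled so that the [n]-th hump has norm at most [3^-n]. *)
pose t n : R := 3^-1 ^+ n / mnorm (y n).
have t0 n : 0 < t n by rewrite divr_gt0 ?exprn_gt0 ?invr_gt0.
pose pick n z := projT1 (cid (hump (y n) z (t0 n))).
have pickP n z : mnorm (pick n z) <= 3^-1 ^+ n /\
    3^-1 ^+ n * mnorm (y n) <= opnorm (mdot (y n) (z + pick n z)).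
  rewrite /pick; case: cid => u /= [].
  have -> : t n * mnorm (y n) = 3^-1 ^+ n by rewrite /t divfK ?gt_eqF.
  by rewrite expr2 mulrA /t divfK ?gt_eqF.
pose s := fix s n := if n is m.+1 then s m + pick m (s m) else 0.
pose u n := pick n (s n).
have sE n : \sum_(0 <= i < n) u i = s n.
  elim: n => [|n IH]; first by rewrite big_geq.
  by rewrite big_nat_recr //= IH.
have r01 : 0 <= (3^-1 : R) < 1 by rewrite invr_ge0 ler0n invf_lt1 ?ltr1n.
have [|z zP] := geometric_sum_limit (u := u) ler01 r01.
  by move=> n; rewrite mul1r; exact: (pickP _ _).1.
(* A preimage of the limit gives the pointwise bound: [<y n, z>] has norm at most [Ka] times that of
   [analysis (y n)]. *)
have [a Ta] := Tsurj z; set Ka := ell2_norm a.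
have Ka0 : 0 <= Ka := sqrtr_ge0 _.
have nrm_yz n h : nrm (mdot (y n) z h) <= ell2_norm (analysis (y n)) * Ka * nrm h.
  rewrite -Ta mdot_analysis; apply: ell2_dot_CS; rewrite ?sqrtr_ge0 // => N k.
    apply: (le_trans (ell2_sqsum_le_dot _ _ _)).
    exact: ell2_dot_le_norm.
  apply: (le_trans (ell2_sqsum_le_dot _ _ _)).
  exact: ell2_dot_le_norm.
(* The later humps sum to at most [3^-(n+1) / (1 - 1/3) = 3^-n / 2], so they undo at most half of
   the [n]-th one. *)
have key n : 3^-1 ^+ n / 2 <= 4^-1 ^+ n * Ka.
  have := (pickP n (s n)).2; rewrite -/(s n.+1) => le.
  have v0 : 0 <= 4^-1 ^+ n * Ka + 3^-1 ^+ n / 2.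
    by rewrite addr_ge0 ?divr_ge0 ?mulr_ge0 ?exprn_ge0 ?invr_ge0.
  have le' : opnorm (mdot (y n) (s n.+1)) <=
      mnorm (y n) * (4^-1 ^+ n * Ka + 3^-1 ^+ n / 2).
    apply: opnorm_le; first by rewrite mulr_ge0 // mnorm_ge0.
    apply/bounded_byE => h.
    have -> : s n.+1 = z - (z - s n.+1) by rewrite opprB addrC subrK.
    rewrite mdotBr vnBE; apply: (le_trans (nrm_triangle _ _)).
    rewrite -[- _]sub0r nrmB subr0 mulrDr mulrDl; apply: lerD.
      apply: (le_trans (nrm_yz n h)); rewrite ler_wpM2r ?nrm_ge0 // mulrA.
      rewrite ler_wpM2r // mulrC exprVn -ler_pdivrMl ?invr_gt0 ?exprn_gt0 //.
      by rewrite invrK ltW.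
    apply: (le_trans (mdot_nrm_le _ _ (y0 n))).
    rewrite ler_wpM2r ?nrm_ge0 // ler_wpM2l ?mnorm_ge0 //.
    rewrite -sE; apply: (le_trans (zP _)); rewrite mul1r exprSr.
    by rewrite le_eqVlt; apply/orP; left; apply/eqP; field.
  have := le_trans le le'; rewrite mulrC ler_pM2l //; lra.
have : (2^-1 : R) <= 0.
  apply: (@le_of_geometric_error _ _ _ Ka (3 / 4)) => [|n].
    by rewrite divr_ge0 //= ltr_pdivrMr // mul1r ltr_nat.
  have := ler_wpM2l (exprn_ge0 n.+1 (ler0n R 3)) (key n.+1).
  by rewrite add0r !mulrA -!exprMn divff ?pnatr_eq0 // expr1n mul1r.
by rewrite leNgt invr_gt0 ltr0n.
Qed.

Lemma frame_of_bounded_surjection : (forall z, exists a, T a = z) ->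
  weak_frame (fun n => T (ell2_e A n)).
Proof.
move=> /analysis_bounded_below [K yK]; apply/weak_frameP.
pose K' := `|K| + 1; have K'0 : 0 < K' by rewrite ltr_wpDl.
have yK' y : mnorm y <= K' * ell2_norm (analysis y).
  apply: (le_trans (yK y)); rewrite ler_wpM2r ?sqrtr_ge0 //.
  by rewrite (le_trans (ler_norm K)) // lerDl.
exists (K' ^+ 2)^-1, (M ^+ 2); split; rewrite ?invr_gt0 ?exprn_gt0 //.
move=> y h; split=> [N|B NB]; first exact: bounded_sqsum.
rewrite mulrC ler_pdivrMr ?exprn_gt0 // mulrC.
apply: (@le_trans _ _ (K' ^+ 2 * rdot (ell2_dot (analysis y) (analysis y) h) h)).
  (* The analysis map commutes with the action of [A], so its lower bound in norm applies to every
     [b *: y]. *)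
  apply: (op_le_of_conjugates (sqr_ge0 K') (ell2_dot_star _ _) (ell2_dot_ge0 _)
    (mdot_star _ _) (mform_ge0 _)) => b L L0 bL {B NB}h.
  have Lb k : rdot (ell2_dot (analysis (b *: y)) (analysis (b *: y)) k) k <=
      Num.sqrt L ^+ 2 * rdot k k.
    have -> : analysis (b *: y) = b *: analysis y.
      by apply: val_inj; apply/funext => n; exact: mdotZl.
    by rewrite ell2_dotZ sqr_sqrtr.
  have bn := (ell2_norm_le _ (sqrtr_ge0 L)).2 Lb.
  have by_ : mnorm (b *: y) <= K' * Num.sqrt L.
    by apply: (le_trans (yK' _)); rewrite ler_wpM2l // ltW.
  have KL0 : 0 <= K' * Num.sqrt L by rewrite mulr_ge0 ?sqrtr_ge0 // ltW.
  have := (mnorm_le _ KL0).1 by_ h.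
  by rewrite exprMn sqr_sqrtr // mformZ.
by rewrite ler_wpM2l ?sqr_ge0 //; apply: ell2_dot_le => N; exact: NB.
Qed.

End BoundedSurjection.

(** * Weak frames as images of the standard sequence, and their stability under surjections *)

Theorem corollary3p12 (R : realType) (H : hilbertType R) (A : vnalg H)
    (X : hilbertModType A) (X_self_dual : self_dual X) :
  (forall x : nat -> X,
     weak_frame x <->
     exists T : {linear ell2 A -> X},
       [/\ bounded_map (@ell2_norm R H A) (@mnorm R H A X) T,
           (forall y : X, exists a : ell2 A, T a = y)
         & forall n : nat, T (ell2_e A n) = x n])
  /\
  (forall x : nat -> X, weak_frame x ->
   forall Y : hilbertModType A, self_dual Y ->
   forall Q : {linear X -> Y},
     bounded_map (@mnorm R H A X) (@mnorm R H A Y) Q ->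
     (forall z : Y, exists y : X, Q y = z) ->
     weak_frame (fun n => Q (x n))).
Proof.
have to_frame (Z : hilbertModType A) (T : {linear ell2 A -> Z}) :
    bounded_map (@ell2_norm R H A) (@mnorm R H A Z) T ->
    (forall z : Z, exists a, T a = z) -> weak_frame (fun n => T (ell2_e A n)).
  (* The bound in [bounded_map] carries no sign, whereas the section asks for a positive one. *)
  move=> [M TM]; have M0 : 0 < `|M| + 1 by rewrite ltr_wpDl.
  apply: (frame_of_bounded_surjection (M := `|M| + 1)) => // a.
  apply: (le_trans (TM a)); rewrite ler_wpM2r ?sqrtr_ge0 //.
  by rewrite (le_trans (ler_norm M)) // lerDl.
have of_frame (x : nat -> X) : weak_frame x -> exists T : {linear ell2 A -> X},
    [/\ bounded_map (@ell2_norm R H A) (@mnorm R H A X) T,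
        (forall y : X, exists a : ell2 A, T a = y)
      & forall n : nat, T (ell2_e A n) = x n].
  move=> /weak_frameP [C [D [C0 D0 xCD]]].
  exists (synthesis X_self_dual D0 xCD); split.
  - exact: synthesis_bounded.
  - exact: synthesis_surjective.
  - exact: synthesis_e.
split=> [x|x /of_frame [T [[M TM] Tsurj Te]] Y _ Q [N QN] Qsurj].
  split=> [/of_frame //|[T [TM Tsurj /funext <-]]]; exact: to_frame.
have -> : (fun n => Q (x n)) = (fun n => (Q \o T) (ell2_e A n)).
  by apply/funext => n; rewrite /= Te.
apply: to_frame => [|z].
  exists (`|N| * M) => a; apply: (le_trans (QN _)).
  apply: (@le_trans _ _ (`|N| * mnorm (T a))).
    by rewrite ler_wpM2r ?mnorm_ge0 // ler_norm.
  by rewrite -mulrA ler_wpM2l.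
by have [y <-] := Qsurj z; have [a <-] := Tsurj y; exists a.
Qed.
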